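(* Let $p,q\ge 2$ be two distinct integers. Then the set $$S_{p,q}:=\bigl\{\mu\in\mathcal{P}_{p,c}(\mathbb{T})\;:\;\limsup_{n\to+\infty}|\widehat{\mu}(q^n)|>0\bigr\}$$ is residual in $(\mathcal{P}_p(\mathbb{T}),w^* )$. In particular, the set $$G_{p,q}:=\bigl\{\mu\in\mathcal{P}_{p,c}(\mathbb{T})\;:\;T_{q^n}\mu \text{ does not converge } w^* \text{ to } \mathrm{Leb} \text{ as } n\to+\infty\bigr\}$$ is residual in $(\mathcal{P}_p(\mathbb{T}),w^* )$.
   Context: $\mathbb{T}=\mathbb{R}/\mathbb{Z}$ is the circle group, identified also with the set of complex numbers $z$ of modulus $1$ via $x\mapsto e^{2i\pi x}$. For an integer $n\ge 1$, $T_n:\mathbb{T}\to\mathbb{T}$ is $x\mapsto nx \bmod 1$ (multiplicatively $z\mapsto z^n$), and for a Borel probability measure $\mu$ on $\mathbb{T}$, $T_n\mu$ is the push-forward measure $T_n\mu(C)=\mu(T_n^{-1}C)$. $\mathcal{P}(\mathbb{T})$ is the set of Borel probability measures on $\mathbb{T}$ with the topology of $w^*$-convergence ($\mu_k\to\mu$ iff $\int f\,d\mu_k\to\int f\,d\mu$ for all continuous $f$ on $\mathbb{T}$). $\mathcal{P}_p(\mathbb{T})$ is the set of $\mu\in\mathcal{P}(\mathbb{T})$ with $T_p\mu=\mu$, with the induced $w^*$-topology (a compact metrizable space), and $\mathcal{P}_{p,c}(\mathbb{T})$ is the set of those $\mu\in\mathcal{P}_p(\mathbb{T})$ which are continuous,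 i.e. have no atom. The Fourier coefficients are $\widehat{\mu}(a)=\int_{\mathbb{T}}z^a\,d\mu(z)$, $a\in\mathbb{Z}$. $\mathrm{Leb}$ is the normalised Lebesgue measure on $\mathbb{T}$. A subset of a Polish space is residual if it contains a dense $G_\delta$ set. *)

(* Defs.v *)
From HB Require Import structures.
From mathcomp Require Import all_boot all_order all_algebra.
From mathcomp Require Import complex.
From mathcomp Require Import all_classical all_reals all_analysis.
From mathcomp Require Import measurable_realfun borel_hierarchy.

Set Implicit Arguments.
Unset Strict Implicit.
Unset Printing Implicit Defensive.

Import Order.TTheory GRing.Theory Num.Theory.
Import numFieldNormedType.Exports.

Local Open Scope classical_set_scope.
Local Open Scope complex_scope.
Local Open Scope ring_scope.

(* R[i]^o carries the topology of the complex modulus; the circle gets the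
   induced topology and its Borel sigma-algebra. *)
Definition circle (R : realType) : Type := {z : R[i] | `|z| == 1}.

HB.instance Definition _ (R : realType) := SubChoice.on (circle R).
HB.instance Definition _ (R : realType) :=
  isPointed.Build (circle R) (exist _ 1 (introT eqP (normr1 _))).
HB.instance Definition _ (R : realType) :=
  Topological.copy (circle R) (initial_topology (val : circle R -> R[i]^o)).
HB.instance Definition _ (R : realType) :=
  Measurable.copy (circle R) (g_sigma_algebraType (@open (circle R))).

Section circle_maps.
Variable R : realType.

Lemma continuous_circle (X : topologicalType) (f : X -> circle R) :
  continuous (fun x => val (f x) : R[i]^o) -> continuous f.
Proof.
move=> /continuousP cf; apply/continuousP => _ [A oA <-].
exact: (cf _ oA).
Qed.

Lemma powc_subproof (n : nat) (z : circle R) : `|val z ^+ n| == 1.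
Proof. by rewrite normrX (eqP (valP z)) expr1n. Qed.

(* The map T_n : z |-> z^n, i.e. x |-> n x on R/Z. *)
Definition powc (n : nat) (z : circle R) : circle R :=
  exist _ (val z ^+ n) (powc_subproof n z).

Lemma continuous_powc n : continuous (powc n).
Proof.
have cv : continuous (fun z : circle R => val z : R[i]^o).
  exact: (@initial_continuous _ _ (val : circle R -> R[i]^o)).
apply: continuous_circle.
suff: continuous (fun z : circle R => (val z : R[i]^o) ^+ n) by [].
elim: n => [|n IHn] z; first exact: (@cst_continuous (circle R) R[i]^o 1).
have -> : (fun z : circle R => (val z : R[i]^o) ^+ n.+1) =
    (fun z => (val z : R[i]^o) * (val z) ^+ n).
  by apply/funext => y; rewrite exprS.
exact: (cvgM (cv z) (IHn z)).
Qed.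

Lemma measurable_powc n : measurable_fun setT (powc n).
Proof.
apply: (measurability (@open (circle R))) => // _ [A oA <-].
rewrite setTI; apply: sub_sigma_algebra.
by move/continuousP : (@continuous_powc n); exact.
Qed.

HB.instance Definition _ n :=
  isMeasurableFun.Build _ _ _ _ (powc n) (measurable_powc n).

Lemma expi_subproof (x : R) :
  `|cos (2 * pi * x) +i* sin (2 * pi * x)| == 1 :> R[i].
Proof. by rewrite normc_def /= cos2Dsin2 sqrtr1. Qed.

(* e^(2 i pi x) *)
Definition expi (x : R) : circle R :=
  exist _ (cos (2 * pi * x) +i* sin (2 * pi * x)) (expi_subproof x).

Lemma continuous_expi : continuous expi.
Proof.
apply: continuous_circle => x.
have cf (g : R -> R) : continuous g -> continuous (fun y => g (2 * pi * y)).
  move=> cg y.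
  apply: (@continuous_comp _ _ _ (fun y => 2 * pi * y)); last exact: cg.
  by apply: cvgM; [exact: cvg_cst|exact: cvg_id].
apply/(@cvgrPdist_lt _ R[i]^o) => -[e e']; rewrite ltcE /= => /andP[/eqP -> e0].
have e20 : 0 < e / 2 by rewrite divr_gt0.
have /cvgrPdist_lt/(_ _ e20) Hc := cf _ (@continuous_cos R) x.
have /cvgrPdist_lt/(_ _ e20) Hs := cf _ (@continuous_sin R) x.
near=> y.
have Hcy : `|cos (2 * pi * x) - cos (2 * pi * y)| < e / 2 by near: y.
have Hsy : `|sin (2 * pi * x) - sin (2 * pi * y)| < e / 2 by near: y.
rewrite (normc_def (_ - _)) ltcR /=.
set a := cos _ - _ in Hcy *; set b := sin _ - _ in Hsy *.
have ab : `|a| + `|b| < e by rewrite (splitr e) ltrD.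
apply: le_lt_trans ab.
rewrite -[leRHS]ger0_norm ?addr_ge0// -sqrtr_sqr ler_wsqrtr// [leRHS]sqrrD.
by rewrite !real_normK ?num_real// -addrA lerD2l lerDr mulrn_wge0 ?mulr_ge0.
Unshelve. all: by end_near. Qed.

Lemma measurable_expi : measurable_fun setT (expi : measurableTypeR R -> _).
Proof.
apply: (measurability (@open (circle R))) => // _ [A oA <-].
rewrite setTI; apply: open_measurable.
by move/continuousP : continuous_expi; exact.
Qed.

HB.instance Definition _ :=
  isMeasurableFun.Build _ _ _ _ (expi : measurableTypeR R -> circle R)
    measurable_expi.

End circle_maps.

(* A `probability` is a function on all subsets, constrained only on the
   measurable ones.  Two measures which agree on Borel sets are thus possibly
   different terms, but they are indistinguishable for the topology below, and
   all the predicates below only evaluate measures on Borel sets (so Gdelta,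
   dense and residual sets are those of the Hausdorff quotient). *)
Definition prob (R : realType) : Type := probability (circle R) R.

Definition integral_eval (R : realType) (mu : probability (circle R) R) :
    {ptws continuousType (circle R) R -> R} :=
  fun f => \int[mu]_z f z.

(* The w*-topology is the coarsest one making mu |-> \int f dmu continuous for
   every continuous f.  Real-valued f suffice: the integral of a complex-valued
   function is taken componentwise. *)
HB.instance Definition _ (R : realType) :=
  Pointed.copy (prob R) (probability (circle R) R).
HB.instance Definition _ (R : realType) :=
  Topological.copy (prob R) (initial_topology (@integral_eval R)).

Lemma cvg_initial (S : choiceType) (T : topologicalType) (f : S -> T)
    (F : set_system S) (s : S) : Filter F ->
  F --> (s : initial_topology f) <-> f @ F --> f s.
Proof.
move=> FF; split=> [h|h].
  by apply: cvg_trans (@initial_continuous S T f s); exact: cvg_app.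
move=> A; rewrite (@nbhsE (initial_topology f)) => -[B [[C oC <-] Cs] BA].
by apply: filterS BA _; apply: h; exact: open_nbhs_nbhs.
Qed.

Lemma cvg_prob (R : realType) (mu_ : nat -> prob R) (mu : prob R) :
  mu_ @ \oo --> mu <->
  forall f : circle R -> R, continuous f ->
    \int[mu_ n]_z f z @[n --> \oo] --> (\int[mu]_z f z : R).
Proof.
have H := @cvg_initial (prob R) _ (@integral_eval R) (mu_ @ \oo) mu _.
split=> [/H h f cf|h].
  pose g : continuousType (circle R) R :=
    HB.pack f (isContinuous.Build _ _ f cf).
  by move: h => /(@cvg_sup _ _ _ _ _ _)/(_ g)/(@cvg_initial _ _ _ _ _ _).
apply/H; apply/(@cvg_sup _ _ _ _ _ _) => g.
apply/(@cvg_initial _ _ _ _ _ _).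
exact: (h g (@cts_fun _ _ g)).
Qed.

Section circle_measures.
Variable R : realType.
Implicit Types (mu : prob R) (n p q : nat).

Definition push n mu : prob R := distribution mu (@powc R n).

Definition Leb : prob R := distribution (uniform_prob (@ltr01 R)) (@expi R).

Definition fourier mu (a : int) : R[i] :=
  (\int[mu]_z complex.Re (val z ^ a)) +i* (\int[mu]_z complex.Im (val z ^ a)).

Definition invariant_prob p : set (prob R) := [set mu |
  forall C : set (circle R), measurable C -> push p mu C = mu C].

Definition atomless mu := forall z : circle R, mu [set z] = 0%E.

(* These are sets of points of the subspace `invariant_prob p` of `prob R`. *)
Definition invariant_atomless p : set (invariant_prob p) :=
  [set mu | atomless (val mu)].

Definition Spq p q : set (invariant_prob p) := [set mu |
  invariant_atomless mu /\
  (0 < limn_esup (fun n =>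
         (Normc.normc (fourier (val mu) (q ^ n)%N%:Z))%:E))%E].

Definition Gpq p q : set (invariant_prob p) := [set mu |
  invariant_atomless mu /\
  ~ (push (q ^ n) (val mu) @[n --> \oo] --> Leb)].

End circle_measures.

Definition residual (X : topologicalType) (S : set X) :=
  exists2 D : set X, Gdelta D /\ dense D & D `<=` S.

(* Main.v *)
Require Import Defs.
From HB Require Import structures.
From mathcomp Require Import all_boot all_order all_algebra.
From mathcomp Require Import cyclic.
From mathcomp Require Import complex.
From mathcomp Require Import all_classical all_reals all_analysis.
From mathcomp Require Import measurable_realfun.
From mathcomp Require Import ring lra zify.

Set Implicit Arguments.
Unset Strict Implicit.
Unset Printing Implicit Defensive.

Import Order.TTheory GRing.Theory Num.Theory.
Import numFieldNormedType.Exports.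

Local Open Scope classical_set_scope.
Local Open Scope complex_scope.
Local Open Scope ring_scope.

(** The proof is a Baire category argument in the closed subspace P_p of the
    compact space of probability measures on the circle, applied to three kinds
    of open sets: the measures all of whose atoms have mass below 1/(n+1), the
    measures mu with mu^(q^p) nonzero, and the measures mu for which some
    n >= N satisfies |mu^(q^n)| > |mu^(q^p)| / 2.  A measure in all of them is
    atomless and has limsup |mu^(q^n)| >= |mu^(q^p)| / 2 > 0.

    Density rests on one family of approximations, [orbit_measure].  Given an
    invariant mu and m >= 2, move each point of the circle to a nearby w with
    w^(p^m) = w, and average the images of the displaced measure under
    z |-> z^(p^i) for i < m.  The average is invariant because the i = m term
    is the i = 0 term.  It is close to mu because the displacement has order
    p^-m, so that its image under z |-> z^(p^i) is small except for a bounded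
    number of values of i close to m ([orbit_measure_near]).
    - If m is prime and w^p <> w, the m points w^(p^i) are distinct, so each
      atom of the approximation has mass at most 1/m ([orbit_measure_atom]).
    - If m is 1 modulo a suitable L, a prime l dividing q cannot divide p^m - 1
      to a power above p: either l divides p, or p^m = p modulo l^p while
      0 < p - 1 < l^p.
      Hence q^(p+n) = q^p modulo p^m - 1 for arbitrarily large n
      ([expn_sub1_eventual_period]), and the coefficient at q^p of the
      approximation recurs along the powers of q ([fourier_orbit_measure]).
      The exponent q^p does not depend on m, which is what makes a single open
      condition out of this recurrence.
    Non-vanishing of mu^(q^p) is obtained by adding to mu a small mass at the
    fixed point 1 ([nonzero_coef_dense]).

    Compactness ([compact_prob]) is proved through distribution functions.
    Along an ultrafilter of measures, the distribution functions converge
    pointwise; the right-continuous modification of the limit defines a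
    Lebesgue-Stieltjes measure, and its image on the circle is the limit.
    Integrals are compared through Stieltjes sums on a regular grid, for which
    a modification of the integrator costs no more than the oscillation of the
    integrand on one cell ([stieltjes_sum_right_limit]).

    Finally, if the push-forwards of mu under z |-> z^(q^n) converged to
    Lebesgue measure, then mu^(q^n) would tend to 0; so the measures with
    positive limsup have non-converging push-forwards ([Spq_sub_Gpq]). *)

(** * The chordal distance and the exponential parametrization *)

Section circle_geometry.
Variable R : realType.
Implicit Types (z w u : circle R) (x y t : R).

(** The complex norm lives in [R[i]]; taking its real part as the distance keeps
    all estimates in [R], at the cost of relating it by hand to the topology
    of the circle ([near_cdist], [nbhs_cdistP]). *)
Definition cdist z w : R := Normc.normc (val z - val w).

Lemma normE (c : R[i]) : `|c| = (Normc.normc c)%:C. Proof. by []. Qed.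

Lemma cdistE z w : (cdist z w)%:C = `|val z - val w|. Proof. by []. Qed.

Lemma cdist_ge0 z w : 0 <= cdist z w.
Proof. by rewrite /cdist -ler0c -normE. Qed.

Lemma cdistC z w : cdist z w = cdist w z.
Proof. by apply: complexI; rewrite -!normE distrC. Qed.

Lemma cdist_triangle u z w : cdist z w <= cdist z u + cdist u w.
Proof. by rewrite -lecR rmorphD /= -!normE ler_distD. Qed.

Lemma cdistzz z : cdist z z = 0.
Proof. by rewrite /cdist subrr Normc.normc0. Qed.

Lemma cdist_eq0 z w : cdist z w = 0 -> z = w.
Proof. by move=> /Normc.eq0_normc /eqP; rewrite subr_eq0 => /eqP/val_inj. Qed.

Lemma circle_val_continuous : continuous (fun z => val z : R[i]^o).
Proof. exact: (@initial_continuous _ _ (val : circle R -> R[i]^o)). Qed.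

Lemma near_cdist z (r : R) : 0 < r -> \forall w \near z, cdist z w < r.
Proof.
move=> r0; have r0' : 0 < r%:C by rewrite ltcR.
have /cvgrPdist_lt/(_ _ r0') := @circle_val_continuous z.
by apply: filterS => w /=; rewrite normE ltcR.
Qed.

Lemma nbhs_cdistP z (A : set (circle R)) :
  nbhs z A -> exists2 r : R, 0 < r & forall w, cdist z w < r -> A w.
Proof.
rewrite (@nbhsE (initial_topology (val : circle R -> R[i]^o))).
move=> -[B [[C oC <-] Cz] BA].
have : nbhs (val z : R[i]^o) C by exact: open_nbhs_nbhs.
move=> /nbhs_ballP[[e e'] /=]; rewrite ltcE/= => /andP[/eqP-> e0] CC.
exists e => // w zw; apply: BA; apply: CC.
by rewrite /ball /= normE ltcR.
Qed.

(** On the unit circle z^n - w^n is a sum of n terms of modulus |z - w|. *)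
Lemma powc_lip n z w : cdist (powc n z) (powc n w) <= n%:R * cdist z w.
Proof.
elim: n => [|n IHn].
  by rewrite (_ : powc 0 z = powc 0 w) ?cdistzz ?mul0r//; apply: val_inj.
move: IHn; rewrite -!lecR !rmorphM/= !cdistE => IHn.
have -> : val (powc n.+1 z) - val (powc n.+1 w) =
  (val z ^+ n - val w ^+ n) * val z + val w ^+ n * (val z - val w).
  by rewrite /= !exprS; ring.
apply: (le_trans (ler_normD _ _)).
rewrite !normrM normrX (eqP (valP z)) (eqP (valP w)) expr1n mulr1 mul1r.
by rewrite -addn1 natrD rmorphD mulrDl mul1r lerD2r.
Qed.

Lemma cos_lip x y : `|cos x - cos y| <= `|x - y|.
Proof.
wlog xy : x y / x <= y.
  by move=> H; case: (leP x y) => [/H//|/ltW/H]; rewrite distrC (distrC y).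
have [c _] := @MVT_segment _ cos (fun c => - sin c) x y xy
   (fun c _ => is_derive_cos c) (continuous_subspaceT (@continuous_cos R)).
rewrite distrC (distrC x) => ->; rewrite normrM normrN ler_piMl//.
by rewrite ler_norml sin_geN1 sin_le1.
Qed.

Lemma sin_lip x y : `|sin x - sin y| <= `|x - y|.
Proof.
wlog xy : x y / x <= y.
  by move=> H; case: (leP x y) => [/H//|/ltW/H]; rewrite distrC (distrC y).
have [c _] := @MVT_segment _ sin cos x y xy
   (fun c _ => is_derive_sin c) (continuous_subspaceT (@continuous_sin R)).
rewrite distrC (distrC x) => ->; rewrite normrM ler_piMl//.
by rewrite ler_norml cos_geN1 cos_le1.
Qed.

Lemma normc_le_ReIm (c : R[i]) :
  Normc.normc c <= `|complex.Re c| + `|complex.Im c|.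
Proof.
case: c => a b /=; rewrite -[leRHS]ger0_norm ?addr_ge0// -sqrtr_sqr.
rewrite ler_wsqrtr// sqrrD !real_normK ?num_real// -addrA lerD2l lerDr.
by rewrite mulrn_wge0 ?mulr_ge0.
Qed.

Lemma expi_lip x y : cdist (expi x) (expi y) <= 4 * pi * `|x - y|.
Proof.
have pi0 := pi_ge0 R.
apply: (le_trans (normc_le_ReIm _)) => /=.
have H : `|2 * pi * x - 2 * pi * y| = 2 * pi * `|x - y|.
  by rewrite -mulrBr normrM ger0_norm// mulr_ge0.
have := cos_lip (2 * pi * x) (2 * pi * y).
have := sin_lip (2 * pi * x) (2 * pi * y).
by rewrite H; lra.
Qed.

Lemma expiD x y : val (expi (x + y)) = val (expi x) * val (expi y).
Proof.
apply/eqP; rewrite eq_complex /= mulrDr cosD sinD.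
by apply/andP; split; apply/eqP; ring.
Qed.

Lemma expi0 : expi 0 = point :> circle R.
Proof. by apply: val_inj => /=; rewrite mulr0 cos0 sin0. Qed.

Lemma powc_expi n x : powc n (expi x) = expi (n%:R * x).
Proof.
apply: val_inj; elim: n => [|n IHn].
  by rewrite mul0r expi0.
by rewrite -natr1 mulrDl mul1r addrC expiD -IHn /= exprS.
Qed.

Lemma expi1 : expi 1 = point :> circle R.
Proof.
by apply: val_inj => /=; rewrite mulr1 mulr_natl cos2pi sin2pi.
Qed.

Lemma powc_point n : powc n point = point :> circle R.
Proof. by apply: val_inj; rewrite /= expr1n. Qed.

Lemma powc_comp m n z : powc m (powc n z) = powc (m * n) z.
Proof. by apply: val_inj; rewrite /= -exprM mulnC. Qed.

Lemma powc1 z : powc 1 z = z.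
Proof. by apply: val_inj; rewrite /= expr1. Qed.

(** 1 - cos (2 pi t) = 2 sin (pi t)^2, and sin is positive on ]0, pi[. *)
Lemma expi_neq1 t : 0 < t < 1 -> expi t <> point.
Proof.
move=> /andP[t0 t1] /(congr1 (fun z => complex.Re (val z))) /=.
have := @sin_gt0_pi R (pi * t); rewrite mulr_gt0 ?pi_gt0// gtr_pMr ?pi_gt0//.
move=> /(_ t1) s0; rewrite -mulrA mulr_natl cos_mulr2n => c.
by have := cos2Dsin2 (pi * t); nra.
Qed.

Lemma expi_surj z : exists2 x, 0 <= x <= 1 & expi x = z.
Proof.
have pi0 := pi_gt0 R.
case: z => -[a b] zP.
have ab : a ^+ 2 + b ^+ 2 = 1.
  move: (zP); rewrite normE /= -(rmorph1 (real_complex R)) => /eqP /complexI.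
  by move=> /(congr1 (fun x => x ^+ 2)); rewrite sqr_sqrtr ?addr_ge0 ?sqr_ge0// expr1n.
have a1 : -1 <= a <= 1 by apply/andP; split; nra.
have /andP[ac0 acpi] : 0 <= acos a <= pi by rewrite acos_ge0// acos_lepi.
have ca : cos (acos a) = a by rewrite acosK.
have sa : sin (acos a) = `|b|.
  by rewrite sin_acos// -ab addrAC subrr add0r sqrtr_sqr.
have pi2 : 2 * pi != 0 :> R by rewrite mulf_neq0// gt_eqF.
have [b0|b0] := leP 0 b.
  exists (acos a / (2 * pi)).
    by rewrite divr_ge0 ?ler_pdivrMr ?mulr_gt0//; lra.
  by apply: val_inj; rewrite /= mulrC divfK// ca sa ger0_norm.
exists (1 - acos a / (2 * pi)).
  have : 0 <= acos a / (2 * pi) <= 1; last lra.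
  by rewrite divr_ge0 ?ler_pdivrMr ?mulr_gt0//; lra.
apply: val_inj; rewrite /= mulrBr mulr1 [2 * pi * (_ / _)]mulrC divfK//.
rewrite mulr_natl addrC cosD2pi -/pi.
by rewrite sinD2pi cosN sinN ca sa ltr0_norm// opprK.
Qed.

End circle_geometry.

(** * Topology of the circle *)

Section circle_topology.
Variable R : realType.
Implicit Types (z w u : circle R) (f : circle R -> R).

Lemma circle_compact : compact [set: circle R].
Proof.
have -> : [set: circle R] = (@expi R) @` `[0, 1].
  apply/esym; rewrite -subTset => z _; have [x x01 <-] := expi_surj z.
  by exists x => //=; rewrite in_itv.
apply: continuous_compact (@segment_compact _ _ _).
exact/continuous_subspaceT/continuous_expi.
Qed.

Lemma continuous_from_circle f :
  (forall z (e : R), 0 < e ->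
     exists2 d : R, 0 < d & forall w, cdist z w < d -> `|f z - f w| < e) ->
  continuous f.
Proof.
move=> H z; apply/(@cvgrPdist_lt _ R^o _ (nbhs z) (nbhs_filter z)) => e /H-/(_ z)[d d0 fd].
by move: (near_cdist z d0); apply: filterS => w; exact: fd.
Qed.

Lemma cdist_continuous w : continuous (fun z => cdist w z).
Proof.
apply: continuous_from_circle => z e e0; exists e => // u zu.
have := cdist_triangle z w u; have := cdist_triangle u w z.
by rewrite (cdistC u z) ltr_norml; lra.
Qed.

Lemma circle_hausdorff : hausdorff_space (circle R).
Proof.
move=> z w zw; apply: cdist_eq0; apply/eqP; rewrite eq_le cdist_ge0 andbT.
rewrite leNgt; apply/negP => d0.
have d20 : 0 < cdist z w / 2 by rewrite divr_gt0.
have [u [/= zu wu]] := zw _ _ (near_cdist z d20) (near_cdist w d20).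
have := cdist_triangle u z w; rewrite (cdistC u w); lra.
Qed.

Lemma open_circle_measurable (A : set (circle R)) : open A -> measurable A.
Proof. exact: sub_sigma_algebra. Qed.

Lemma closed_circle_measurable (A : set (circle R)) : closed A -> measurable A.
Proof.
move=> cA; rewrite -[A]setCK; apply: measurableC.
by apply: open_circle_measurable; exact: closed_openC.
Qed.

Lemma continuous_circle_measurable f : continuous f -> measurable_fun setT f.
Proof.
move=> /continuousP cf; apply: (measurability _ (RGenOpens.measurableE R)).
move=> _ [_ [x [y ->]] <-]; rewrite setTI.
by apply: open_circle_measurable; apply: cf; exact: interval_open.
Qed.

Lemma continuous_circle_bounded f : continuous f -> exists B : R, forall z, `|f z| <= B.
Proof.
move=> cf.
have : compact (f @` [set: circle R]).
  by apply: continuous_compact circle_compact; exact: continuous_subspaceT.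
move=> /compact_bounded[B [_ HB]]; exists (B + 1) => z.
by apply: (HB (B + 1)); [rewrite ltrDl|exists z].
Qed.

(** Compactness, in its near-covering form with the filter of small d > 0. *)
Lemma continuous_circle_unif f (e : R) : continuous f -> 0 < e ->
  exists2 d : R, 0 < d & forall z w, cdist z w < d -> `|f z - f w| < e.
Proof.
move=> cf e0.
have : \forall d \near (0:R)^'+,
    [set: circle R] `<=` [set z | forall w, cdist z w < d -> `|f z - f w| < e].
  apply: (iffLR (compact_near_coveringP _) circle_compact) => z _.
  have e20 : 0 < e / 2 by rewrite divr_gt0.
  have /cvgrPdist_lt/(_ _ e20)/nbhs_cdistP[r r0 fr] := cf z.
  have r20 : 0 < r / 2 by rewrite divr_gt0.
  exists ([set u | cdist z u < r / 2], [set d | d < r / 2]) => /=.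
    by split; [exact: near_cdist|exact: nbhs_right_lt].
  move=> [u d] /= [zu dr] w uw.
  have fu : `|f z - f u| < e / 2 by apply: fr; lra.
  have fw : `|f z - f w| < e / 2 by apply: fr; have := cdist_triangle u z w; lra.
  by move: fu fw; rewrite !ltr_norml; lra.
move=> /(filterI (nbhs_right_gt (0:R))) /filter_ex[d [d0 H]].
by exists d => // z w; exact: H.
Qed.

End circle_topology.

(** * Integrals of bounded functions and averages of measures *)

Section bounded_integrals.
Context d (T : measurableType d) (R : realType).
Implicit Types (P : probability T R) (f g : T -> R).

Lemma bounded_integrable P f B : measurable_fun setT f ->
  (forall x, `|f x| <= B) -> P.-integrable setT (EFin \o f).
Proof.
move=> mf fB; apply: measurable_bounded_integrable => //.
  by rewrite (le_lt_trans (probability_le1 P _)) ?ltry.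
by exists B; split; [exact: num_real|move=> M BM x _; apply: le_trans (fB x) (ltW BM)].
Qed.

Lemma Rintegral_prob_cst P (c : R) : \int[P]_x c = c.
Proof.
by rewrite Rintegral_cst// [X in fine X]probability_setT mulr1.
Qed.

Lemma le_Rintegral_dist P f g B e : measurable_fun setT f -> measurable_fun setT g ->
  (forall x, `|f x| <= B) -> (forall x, `|f x - g x| <= e) ->
  `|\int[P]_x f x - \int[P]_x g x| <= e.
Proof.
move=> mf mg fB fge.
have gB x : `|g x| <= B + e.
  have := fge x; have := fB x; rewrite !ler_norml; lra.
have If := bounded_integrable P mf fB; have Ig := bounded_integrable P mg gB.
rewrite -RintegralB//.
have Ifg : P.-integrable setT (EFin \o (fun x => f x - g x)).
  by apply: (@bounded_integrable _ _ e) => //; exact: measurable_funB.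
apply: le_trans (le_normr_Rintegral _ Ifg) _ => //.
rewrite -[leRHS](Rintegral_prob_cst P); apply: le_Rintegral => //.
- apply: (@bounded_integrable _ _ e) => [|x]; last by rewrite normr_id.
  by apply: measurableT_comp => //; exact: measurable_funB.
- exact: finite_measure_integrable_cst.
Qed.

Lemma Rintegral_prob_norm_le P f (B : R) : measurable_fun setT f ->
  (forall x, `|f x| <= B) -> `|\int[P]_x f x| <= B.
Proof.
move=> mf fB; have /= := @le_Rintegral_dist P f (cst 0) B B mf _ fB.
rewrite Rintegral_prob_cst subr0; apply => // x; by rewrite subr0.
Qed.

Section average.
Variables (n : nat) (m : nat -> probability T R).

Definition average : set T -> \bar R :=
  mscale (n.+1%:R^-1)%:nng (msum (fun i => m i : measure T R) n.+1).

HB.instance Definition _ := Measure.on average.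

Lemma averageE A : average A = ((n.+1%:R^-1)%:E * \sum_(i < n.+1) m i A)%E.
Proof. by []. Qed.

Let average_setT : average setT = 1%E.
Proof.
rewrite averageE (eq_bigr (fun=> 1%:E)) => [|i _]; last exact: probability_setT.
by rewrite sumEFin big_const_ord iter_addr_0 -EFinM mulVf.
Qed.

HB.instance Definition _ := Measure_isProbability.Build _ _ _ average average_setT.

(** Additivity in the measure is applied to the nonnegative integrand f + B. *)
Lemma Rintegral_average f B : measurable_fun setT f -> (forall x, `|f x| <= B) ->
  \int[average]_x f x = n.+1%:R^-1 * \sum_(i < n.+1) \int[m i]_x f x.
Proof.
move=> mf fB.
pose g x := f x + B.
have mg : measurable_fun setT g by exact: measurable_funD.
have g0 x : 0 <= g x by have := fB x; rewrite ler_norml /g; lra.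
have gB x : `|g x| <= B + B.
  by rewrite ger0_norm// lerD2r; have := fB x; rewrite ler_norml; lra.
have gP P : \int[P]_x g x = \int[P]_x f x + B.
  rewrite RintegralD ?Rintegral_prob_cst//; first exact: (bounded_integrable P mf fB).
  exact: finite_measure_integrable_cst.
have : \int[average]_x g x = n.+1%:R^-1 * \sum_(i < n.+1) \int[m i]_x g x.
  rewrite {1}/Rintegral /average ge0_integral_mscale//; last 2 first.
  - exact/measurable_EFinP.
  - by move=> x _; rewrite lee_fin.
  rewrite ge0_integral_measure_sum//; last 2 first.
  - by move=> x _; rewrite lee_fin.
  - exact/measurable_EFinP.
  rewrite (eq_bigr (fun i : 'I_n.+1 => (\int[m i]_x g x)%:E)); last first.
    move=> i _; rewrite /Rintegral fineK// integrable_fin_num//.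
    exact: (bounded_integrable (m i) mg gB).
  by rewrite sumEFin -EFinM.
under eq_bigr do rewrite gP.
rewrite gP big_split /= mulrDr big_const_ord iter_addr_0.
by rewrite -[B *+ _]mulr_natl mulKf// => /addIr.
Qed.

End average.
End bounded_integrals.

Section circle_integrals.
Variable R : realType.
Implicit Types (mu : prob R) (f : circle R -> R).

Lemma Rintegral_distribution d (T : measurableType d) (P : probability T R)
    (X : {mfun T >-> circle R}) f (B : R) :
  measurable_fun setT f -> (forall x, `|f x| <= B) ->
  \int[distribution P X]_z f z = \int[P]_x f (X x).
Proof.
move=> mf fB; rewrite /Rintegral integral_distribution//; first exact/measurable_EFinP.
apply: (@bounded_integrable _ _ _ P (f \o X) B) => //.
  by apply: measurableT_comp.
by move=> x; exact: fB.
Qed.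

End circle_integrals.

(** * Stieltjes sums and measures with a given distribution function *)

Section riemann_stieltjes.
Context d (T : measurableType d) (R : realType).

Lemma fin_prob (P : probability T R) (A : set T) : measurable A ->
  P A \is a fin_num.
Proof. by move=> mA; exact: fin_num_measure. Qed.

(** On each layer [A j.+1 `\` A j] the function g is within e of the constant
    [c j], and the errors add up to e times the mass of the last set.  The
    layers will be arcs of the circle in one use and half-lines in the other,
    which is why the space is abstract. *)
Lemma stieltjes_sum_approx (P : probability T R) (g : T -> R) (B e : R)
    (A : nat -> set T) (c : nat -> R) :
  measurable_fun setT g -> (forall x, `|g x| <= B) ->
  A 0%N = set0 -> (forall j, measurable (A j)) -> (forall j, A j `<=` A j.+1) ->
  (forall j x, A j.+1 x -> ~ A j x -> `|g x - c j| <= e) ->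
  forall N, `|\int[P]_(x in A N) g x -
      \sum_(j < N) c j * (fine (P (A j.+1)) - fine (P (A j)))|
    <= e * fine (P (A N)).
Proof.
move=> mg gB A0 mA ndA gc; elim=> [|N IHN].
  by rewrite A0 Rintegral_set0 big_ord0 subr0 normr0 measure0 mulr0.
have mD : measurable (A N.+1 `\` A N) by exact: measurableD.
have AD : A N `&` (A N.+1 `\` A N) = set0 by rewrite setDE setICA setICr setI0.
have AU : A N.+1 = A N `|` (A N.+1 `\` A N) by rewrite setDUK.
have PD : fine (P (A N.+1)) = fine (P (A N)) + fine (P (A N.+1 `\` A N)).
  by rewrite {1}AU measureU// fineD ?fin_prob.
have Ig (D : set T) : measurable D -> P.-integrable D (EFin \o g).
  move=> mD'; apply: integrableS (bounded_integrable P mg gB) => //.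
have -> : \int[P]_(x in A N.+1) g x =
    \int[P]_(x in A N) g x + \int[P]_(x in A N.+1 `\` A N) g x.
  rewrite {1}AU Rintegral_setU//; first by rewrite -AU; exact: Ig.
  by apply/disj_setPS; rewrite AD.
rewrite big_ord_recr /= PD [X in c N * (X - _)]addrC addrK mulrDr.
have : `|\int[P]_(x in A N.+1 `\` A N) g x - c N * fine (P (A N.+1 `\` A N))|
    <= e * fine (P (A N.+1 `\` A N)).
  have Ic r : P.-integrable (A N.+1 `\` A N) (EFin \o cst r).
    exact: finite_measure_integrable_cst.
  rewrite ler_distl -!mulrBl -mulrDl -!(Rintegral_cst P mD).
  by apply/andP; split; apply: le_Rintegral => //; 
    (try exact: Ic); (try exact: Ig) => x [ANx nANx];
    have := gc _ _ ANx nANx; rewrite ler_distl => /andP[].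
move: IHN; set I1 := Rintegral _ _ _; set I2 := Rintegral _ _ _.
set S := \sum_(_ < _) _.
by rewrite !ler_norml; lra.
Qed.

End riemann_stieltjes.

Section cdf_measure.
Variable R : realType.
Implicit Types (F G : R -> R).

Lemma probability_of_cdf F : nondecreasing F -> right_continuous F ->
  (forall x, x < 0 -> F x = 0) -> (forall x, 1 <= x -> F x = 1) ->
  exists P : probability (measurableTypeR R) R, forall x : R, P `]-oo, x]%classic = (F x)%:E.
Proof.
move=> nF rF F0 F1.
have FN : F @ -oo --> (0:R).
  apply: cvg_near_cst; near=> x; apply: F0; near: x; exact: nbhs_ninfty_lt.
have Fy : F @ +oo --> (1:R).
  apply: cvg_near_cst; near=> x; apply: F1; near: x; exact: nbhs_pinfty_ge.
pose F' : cumulativeBounded (0:R) (1:R) :=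
  HB.pack F (isCumulative.Build R _ R F nF rF) (isCumulativeBounded.Build R 0 1 F FN Fy).
exists (lebesgue_stieltjes_measure F') => x.
exact: (cdf_lebesgue_stieltjes_id F').
Unshelve. all: by end_near. Qed.

(** For a nondecreasing G this is the limit of G at x from the right, hence its
    right-continuous modification. *)
Definition right_limit G x := inf [set G y | y in [set y | x < y]].

Section right_limit.
Variable G : R -> R.
Hypotheses (ndG : nondecreasing G) (G0 : forall x, x < 0 -> G x = 0)
  (G1 : forall x, 1 <= x -> G x = 1).

Let has_inf_G x : has_inf [set G y | y in [set y | x < y]].
Proof.
split; first by exists (G (x + 1)), (x + 1) => //=; rewrite ltrDl.
by exists (G x) => _ [y /= xy <-]; exact/ndG/ltW.
Qed.

Lemma right_limit_ge x : G x <= right_limit G x.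
Proof.
apply: lb_le_inf; first by case: (has_inf_G x).
by move=> _ [y /= xy <-]; exact/ndG/ltW.
Qed.

Lemma right_limit_le x y : x < y -> right_limit G x <= G y.
Proof. by move=> xy; apply: ge_inf; [case: (has_inf_G x)|exists y]. Qed.

Lemma nondecreasing_right_limit : nondecreasing (right_limit G).
Proof.
move=> x y xy; apply: lb_le_inf; first by case: (has_inf_G y).
by move=> _ [z /= yz <-]; apply: right_limit_le; exact: le_lt_trans yz.
Qed.

Lemma right_continuous_right_limit : right_continuous (right_limit G).
Proof.
move=> x; apply/cvgrPdist_lt => e e0.
have [_ [y /= xy <-] Gy] := inf_adherent e0 (has_inf_G x).
near=> t; have xt : x < t by near: t; exact: nbhs_right_gt.
have ty : t < y by near: t; exact: nbhs_right_lt.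
have := right_limit_le ty; have := nondecreasing_right_limit (ltW xt).
by rewrite -/(right_limit G x) in Gy; rewrite ltr_norml; lra.
Unshelve. all: by end_near. Qed.

Lemma right_limit0 x : x < 0 -> right_limit G x = 0.
Proof.
move=> x0; have := right_limit_ge x; rewrite (G0 x0) => Gx.
apply/eqP; rewrite eq_le Gx andbT.
have x2 : x / 2 < 0 by lra.
by rewrite -(G0 x2); apply: right_limit_le; lra.
Qed.

Lemma right_limit1 x : 1 <= x -> right_limit G x = 1.
Proof.
move=> x1; have := right_limit_ge x; rewrite (G1 x1) => Gx.
apply/eqP; rewrite eq_le Gx andbT.
have x2 : 1 <= x + 1 by lra.
by rewrite -(G1 x2); apply: right_limit_le; lra.
Qed.

End right_limit.
End cdf_measure.

Section ultrafilter_limits.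
Variable R : realType.

(** By compactness the image filter has a cluster point.  Of each neighbourhood V
    of it and the complement of V, one has its preimage in U, and it can only
    be V. *)
Lemma ultra_bounded_cvg (T : Type) (U : set_system T) (h : T -> R) (a b : R) :
  UltraFilter U -> (forall t, a <= h t <= b) ->
  exists2 l : R, a <= l <= b & h @ U --> l.
Proof.
move=> UU hab.
have FU : ProperFilter U by exact: ultra_proper.
have Uab : (h @ U) `[a, b]%classic by apply: (@filterE _ U) => t /=; rewrite in_itv hab.
have [l [/=]] := @segment_compact R a b (h @ U) _ Uab.
rewrite in_itv /= => lab ll; exists l => // V Vl.
have [//|UV] := in_ultra_setVsetC (h @^-1` V) UU.
by have [x []] := ll (~` V) V UV Vl.
Qed.

End ultrafilter_limits.

Section stieltjes_sums.
Variable R : realType.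
Implicit Types (f : circle R -> R) (mu : prob R) (H G : R -> R) (M N : nat).

Lemma abel_summation (c D : nat -> R) N :
  \sum_(j < N) c j * (D j.+1 - D j) =
  c N * D N - c 0%N * D 0%N - \sum_(j < N) (c j.+1 - c j) * D j.+1.
Proof.
elim: N => [|N IHN]; first by rewrite !big_ord0 subrr subr0.
by rewrite !big_ord_recr /= IHN; ring.
Qed.

(** The grid starts at -1/M, where distribution functions vanish, so that a mass
    at 0 is counted in the first increment. *)
Definition grid M (j : nat) : R := (j%:R - 1) / M%:R.

Lemma gridS M j : grid M j.+1 = grid M j + M%:R^-1.
Proof. by rewrite /grid -natr1; ring. Qed.

Lemma grid1 M : grid M 1 = 0. Proof. by rewrite /grid subrr mul0r. Qed.

Lemma gridM M : (0 < M)%N -> grid M M.+1 = 1.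
Proof. by move=> M0; rewrite /grid -natr1 addrK divff// pnatr_eq0 -lt0n. Qed.

Definition stieltjes_sum f M H : R :=
  \sum_(j < M.+1) f (expi (grid M j.+1)) * (H (grid M j.+1) - H (grid M j)).

Definition is_cdf01 H := [/\ nondecreasing H, forall x, x < 0 -> H x = 0 &
  forall x, 1 <= x -> H x = 1].

Variables (f : circle R -> R) (B e del : R) (M : nat).
Hypotheses (mf : measurable_fun setT f) (fB : forall z, `|f z| <= B).
Hypothesis (fe : forall z w, cdist z w < del -> `|f z - f w| <= e).
Hypotheses (M0 : (0 < M)%N) (Mdel : 4 * pi / M%:R < del).

Let Mr0 : 0 < M%:R :> R. Proof. by rewrite ltr0n. Qed.

Let grid0 : grid M 0 < 0.
Proof. by rewrite /grid sub0r mulN1r oppr_lt0 invr_gt0. Qed.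

Lemma grid_close x y : `|x - y| <= M%:R^-1 -> `|f (expi x) - f (expi y)| <= e.
Proof.
move=> xy; apply: fe; apply: le_lt_trans (expi_lip _ _) _.
by apply: le_lt_trans Mdel; rewrite ler_pM2l// mulr_gt0// pi_gt0.
Qed.

(** Summation by parts turns the difference of the sums into the increments of
    f between consecutive grid points, each at most e, weighted by the
    differences of the two integrators.  Since the right limit of G at a grid
    point is at most the value of G at the next one, the weights telescope to
    at most 1, even if G jumps at grid points. *)
Lemma stieltjes_sum_right_limit G : is_cdf01 G ->
  `|stieltjes_sum f M (right_limit G) - stieltjes_sum f M G| <= e.
Proof.
move=> [ndG G0 G1]; have e0 : 0 <= e.
  by have := @grid_close 0 0; rewrite !subrr !normr0; apply; rewrite invr_ge0 ltW.
rewrite /stieltjes_sum -sumrB.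
pose c j := f (expi (grid M j.+1)).
pose D j := right_limit G (grid M j) - G (grid M j).
rewrite (eq_bigr (fun j : 'I_M.+1 => c j * (D j.+1 - D j))); last first.
  by move=> j _; rewrite /c /D; ring.
have D00 : D 0%N = 0 by rewrite /D right_limit0// G0// subrr.
have DM : D M.+1 = 0 by rewrite /D gridM// right_limit1// G1// subrr.
rewrite abel_summation D00 DM !mulr0 subrr sub0r normrN.
apply: le_trans (ler_norm_sum _ _ _) _.
apply: (@le_trans _ _ (\sum_(j < M.+1) e * (G (grid M j.+2) - G (grid M j.+1)))).
  apply: ler_sum => j _; rewrite normrM; apply: ler_pM => //.
    by apply: grid_close; rewrite gridS addrAC subrr add0r ger0_norm ?invr_ge0// ltW.
  rewrite /D ger0_norm ?subr_ge0 ?right_limit_ge// lerD2r.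
  by apply: right_limit_le => //; rewrite [ltRHS]gridS ltrDl invr_gt0.
rewrite -mulr_sumr ler_piMr//.
rewrite -(big_mkord xpredT (fun j => G (grid M j.+2) - G (grid M j.+1))).
rewrite (telescope_sumr (fun j => G (grid M j.+1)))//.
rewrite (G1 (grid M M.+2)) ?grid1; last by rewrite gridS gridM// lerDl invr_ge0 ltW.
have : G (-1) <= G 0 by apply: ndG; lra.
by rewrite (G0 (-1)); lra.
Qed.

(** A measure on R whose distribution function is 0 on the negative numbers and 1
    from 1 on is carried by [0, 1]; composing with [clamp] uses only the
    values on [0, 1] without having to restrict the measure. *)
Definition clamp (t : R) : R := Num.max 0 (Num.min 1 t).

Lemma stieltjes_sum_line (P : probability (measurableTypeR R) R) H :
  is_cdf01 H -> (forall x, P `]-oo, x]%classic = (H x)%:E) ->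
  measurable_fun setT (f \o @expi R \o clamp : measurableTypeR R -> R) ->
  `|\int[P]_t f (expi (clamp t)) - stieltjes_sum f M H| <= e.
Proof.
move=> [ndH H0 H1] PH mY.
(* The half-lines up to the grid points, with the first and last replaced by
   set0 and setT so that the layers cover R; this does not change the masses. *)
pose A j : set (measurableTypeR R) := if j == 0%N then set0 else
  if (M < j)%N then setT else `]-oo, grid M j]%classic.
have := @stieltjes_sum_approx _ _ _ P (f \o @expi R \o clamp) B e A
  (fun j => f (expi (grid M j.+1))) mY (fun x => fB _).
have HA j : (j <= M.+1)%N -> fine (P (A j)) = H (grid M j).
  rewrite /A; case: j => [_|j jM] /=; first by rewrite measure0 H0.
  case: ltnP => Mj; last by rewrite PH.
  have -> : j.+1 = M.+1 by lia.
  by rewrite gridM// H1// probability_setT.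
have grid_le j k : (j <= k)%N -> grid M j <= grid M k.
  by move=> jk; rewrite /grid ler_pM2r ?invr_gt0// lerD2r ler_nat.
have H1' : A 0%N = set0 by [].
have H2' j : measurable (A j).
  rewrite /A; case: ifP => // _; case: ifP => // _; exact: measurable_itv.
have H3' j : A j `<=` A j.+1.
  rewrite /A; case: j => //= j; case: (ltnP M j.+1) => Mj; first by rewrite ltnS ltnW.
  case: ifP => // _ t /=; rewrite !in_itv /= => /le_trans; apply; exact: grid_le.
move=> /(_ H1' H2' H3'); have H4' j (x : R) : A j.+1 x -> ~ A j x ->
    `|(f \o expi (R:=R) \o clamp) x - f (expi (grid M j.+1))| <= e.
  move=> /= Ax nAx; apply: grid_close; rewrite gridS.
  have Mi : 0 < M%:R^-1 :> R by rewrite invr_gt0.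
  have jM : (j <= M)%N.
    by rewrite leqNgt; apply/negP => Mj; apply: nAx; rewrite /A Mj; case: j Mj {Ax}.
  have xj : (j == 0%N) || (grid M j < x).
    case: eqP => //= /eqP j0; rewrite ltNge; apply/negP => xj; apply: nAx.
    by rewrite /A (negPf j0) ltnNge jM /= in_itv.
  have xj' : (j == M) || (x <= grid M j + M%:R^-1).
    case: eqP => //= /eqP jM'; move: Ax; rewrite /A /= ltnNge ltn_neqAle jM' jM /=.
    by rewrite in_itv /= gridS.
  have gM : grid M M = 1 - M%:R^-1 by have := gridM M0; rewrite gridS; lra.
  have g0 : grid M 0 = - M%:R^-1 by rewrite /grid sub0r mulN1r.
  have gj0 : grid M 0 <= grid M j by exact: grid_le.
  have gjM : grid M j <= grid M M by exact: grid_le.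
  have gj1 : j != 0%N -> 0 <= grid M j.
    by move=> j0; rewrite -(grid1 M); apply: grid_le; rewrite lt0n.
  have Hk : [/\ 0 <= clamp x, clamp x <= 1, x <= 0 -> clamp x = 0 &
      0 <= x -> clamp x <= x] /\ ((x <= 1 -> x <= clamp x) /\ (1 < x -> clamp x = 1)).
    rewrite /clamp maxEle minEle; split; [split|split];
    by case: (leP 1 x) => x1; [case: (leP 0 1)|case: (leP 0 x)] => ?; lra.
  case: Hk => -[k0 k1 kx0 kx [kx1 kx2]]; rewrite ler_norml.
  move: xj gj1; have [j0 _ _|j0 /= xj /(_ isT) gj1] := eqVneq j 0%N.
    move: xj'; rewrite j0 g0 (ltn_eqF M0) orFb addNr => x0.
    by rewrite kx0 ?x0 // subrr oppr_le0 (ltW Mi).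
  move: xj'; have [jM' _|_ /= x1] := eqVneq j M.
    by rewrite jM' in xj gj1 *; case: (leP x 1) => [/kx1|/kx2]; lra.
  have : x <= 1 by lra.
  have : 0 <= x by lra.
  by move=> /kx + /kx1; lra.
move=> /(_ H4' M.+1); rewrite {1 4}/A /= ltnSn probability_setT mulr1.
rewrite (eq_bigr (fun j : 'I_M.+1 =>
  f (expi (grid M j.+1)) * (H (grid M j.+1) - H (grid M j))))//.
by move=> [j jM] _ /=; rewrite !HA// ltnW.
Qed.

End stieltjes_sums.

(** * Compactness of the space of probability measures *)

Section prob_topology.
Variable R : realType.
Implicit Types (mu nu : prob R) (f : circle R -> R).

(** [cvg_prob] for an arbitrary filter in place of a sequence. *)
Lemma cvg_prob_filter (F : set_system (prob R)) (mu : prob R) : Filter F ->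
  (forall f, continuous f -> \int[nu]_z f z @[nu --> F] --> (\int[mu]_z f z : R)) ->
  F --> mu.
Proof.
move=> FF h; apply/(@cvg_initial (prob R) _ (@integral_eval R) F mu FF).
apply/(@cvg_sup _ _ _ _ _ _) => g; apply/(@cvg_initial _ _ _ _ _ _).
exact: (h g (@cts_fun _ _ g)).
Qed.

Lemma continuous_prob_integral f : continuous f ->
  continuous (fun mu : prob R => \int[mu]_z f z : R).
Proof.
move=> cf mu.
pose g : continuousType (circle R) R := HB.pack f (isContinuous.Build _ _ f cf).
have H : nbhs mu --> (mu : prob R) by [].
have := (@cvg_initial (prob R) _ (@integral_eval R) (nbhs mu) mu (nbhs_filter mu)).1 H.
by move=> /(@cvg_sup _ _ _ _ _ _)/(_ g)/(@cvg_initial _ _ _ _ _ _).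
Qed.

End prob_topology.

Section prob_compact.
Variable R : realType.
Implicit Types (mu nu : prob R) (f : circle R -> R).

Definition arc (x : R) : set (circle R) := @expi R @` `[0, x].

Definition circle_cdf mu (x : R) : R := fine (mu (arc x)).

Lemma measurable_arc x : measurable (arc x).
Proof.
apply: closed_circle_measurable; apply: compact_closed; first exact: circle_hausdorff.
apply: continuous_compact (@segment_compact _ _ _).
exact/continuous_subspaceT/continuous_expi.
Qed.

Lemma subset_arc x y : x <= y -> arc x `<=` arc y.
Proof.
move=> xy z [t /=]; rewrite in_itv /= => /andP[t0 tx] tz; exists t => //=.
by rewrite in_itv /= t0 (le_trans tx).
Qed.

Lemma arc0 x : x < 0 -> arc x = set0.
Proof.
move=> x0; rewrite -subset0 => z [t /=]; rewrite in_itv /= => /andP[t0 tx] tz.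
by have := lt_le_trans x0 t0; rewrite ltNge tx.
Qed.

Lemma arc1 x : 1 <= x -> arc x = setT.
Proof.
move=> x1; rewrite -subTset => z _; have [t /andP[t0 t1] <-] := expi_surj z.
by exists t => //=; rewrite in_itv /= t0 (le_trans t1).
Qed.

Lemma is_cdf01_circle_cdf mu : is_cdf01 (circle_cdf mu).
Proof.
split=> [x y xy|x x0|x x1]; rewrite /circle_cdf.
- apply: fine_le; rewrite ?fin_prob//; try exact: measurable_arc.
  by apply: le_measure; rewrite ?inE; [exact: measurable_arc..|exact: subset_arc].
- by rewrite arc0 // measure0.
- by rewrite arc1 // probability_setT.
Qed.

Lemma circle_cdf01 mu x : 0 <= circle_cdf mu x <= 1.
Proof.
rewrite fine_ge0//= -lee_fin fineK ?fin_prob ?probability_le1//; exact: measurable_arc.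
Qed.

Lemma stieltjes_sum_circle f (B e del : R) (M : nat) : measurable_fun setT f ->
  (forall z, `|f z| <= B) -> (forall z w, cdist z w < del -> `|f z - f w| <= e) ->
  (0 < M)%N -> 4 * pi / M%:R < del ->
  forall mu, `|\int[mu]_z f z - stieltjes_sum f M (circle_cdf mu)| <= e.
Proof.
move=> mf fB fe M0 Mdel mu.
have := @stieltjes_sum_approx _ _ _ mu f B e (fun j => arc (grid R M j))
  (fun j => f (expi (grid R M j.+1))) mf fB.
rewrite arc0 => [/(_ erefl (fun j => measurable_arc _))|]; last first.
  by rewrite /grid sub0r mulN1r oppr_lt0 invr_gt0 ltr0n.
have nd j : arc (grid R M j) `<=` arc (grid R M j.+1).
  by apply: subset_arc; rewrite gridS lerDl invr_ge0.
move=> /(_ nd) H; have /H/(_ M.+1) : forall j z, arc (grid R M j.+1) z ->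
    ~ arc (grid R M j) z -> `|f z - f (expi (grid R M j.+1))| <= e.
  move=> j z [t /=]; rewrite in_itv /= => /andP[t0 tj] tz ntj; rewrite -{}tz in ntj *.
  apply: (grid_close fe Mdel) => //; rewrite gridS in tj *.
  have : grid R M j < t.
    by rewrite ltNge; apply/negP => tj'; apply: ntj; exists t => //=; rewrite in_itv/= t0.
  by rewrite ler_norml; lra.
by rewrite gridM// arc1// probability_setT mulr1.
Qed.

Lemma cvg_stieltjes_sum f M (U : set_system (prob R)) (G : R -> R) : ProperFilter U ->
  (forall x, circle_cdf nu x @[nu --> U] --> G x) ->
  stieltjes_sum f M (circle_cdf nu) @[nu --> U] --> stieltjes_sum f M G.
Proof.
move=> FU UG; rewrite /stieltjes_sum.
apply: cvg_big => [|j _]; first exact: add_continuous.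
by apply: cvgM; [exact: cvg_cst|apply: cvgB; exact: UG].
Qed.

Lemma measurable_expi_clamp :
  measurable_fun setT (@expi R \o @clamp R : measurableTypeR R -> circle R).
Proof.
apply: measurableT_comp; first exact: measurable_expi.
apply: measurable_maxr => //; exact: measurable_minr.
Qed.

(** Given an ultrafilter of measures, the distribution functions converge
    pointwise to some G.  The limit is the image of the Lebesgue-Stieltjes
    measure of the right limit of G.  For a continuous f the integral and its
    Stieltjes sum differ by at most e / 4, uniformly in the measure; the sum,
    being a finite combination of values of the distribution function,
    passes to the limit. *)
Theorem compact_prob : compact [set: prob R].
Proof.
rewrite compact_ultra => U UU _.
have FU : ProperFilter U by exact: ultra_proper.
have UUx (x : R) : exists l : R, circle_cdf nu x @[nu --> U] --> l.
  have [l _ Ul] := ultra_bounded_cvg UU (fun nu => circle_cdf01 nu x).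
  by exists l.
have [G UG] := boolp.choice UUx.
have cG : is_cdf01 G.
  split=> [x y xy|x x0|x x1].
  - apply: ler_cvg_to (UG x) (UG y) _; apply: nearW => nu.
    by have [nd _ _] := is_cdf01_circle_cdf nu; exact: nd.
  - apply: (cvg_unique _ (UG x)) => //; apply: cvg_near_cst; apply: nearW => nu.
    by have [_ H _] := is_cdf01_circle_cdf nu; exact: H.
  - apply: (cvg_unique _ (UG x)) => //; apply: cvg_near_cst; apply: nearW => nu.
    by have [_ _ H] := is_cdf01_circle_cdf nu; exact: H.
have [ndG G0 G1] := cG.
have rG0 := right_limit0 ndG G0; have rG1 := right_limit1 ndG G1.
have ndr := nondecreasing_right_limit ndG.
have [P PG] := probability_of_cdf ndr (right_continuous_right_limit ndG) rG0 rG1.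
pose Y : {mfun measurableTypeR R >-> circle R} :=
  HB.pack (@expi R \o @clamp R : measurableTypeR R -> circle R)
    (isMeasurableFun.Build _ _ _ _ _ measurable_expi_clamp).
exists (distribution P Y : prob R); split => //=.
apply: cvg_prob_filter => f cf.
have mf := continuous_circle_measurable cf; have [B fB] := continuous_circle_bounded cf.
apply/cvgrPdist_lt => e e0; have e40 : 0 < e / 4 by rewrite divr_gt0.
have [del del0 fdel] := continuous_circle_unif cf e40.
have fdel' z w : cdist z w < del -> `|f z - f w| <= e / 4 by move=> /fdel/ltW.
pose M := (Num.truncn (4 * pi / del)).+1.
have Mdel : 4 * pi / M%:R < del.
  by rewrite ltr_pdivrMr ?ltr0n// (mulrC del) -ltr_pdivrMr// truncnS_gt.
have M0 : (0 < M)%N by [].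
have /cvgrPdist_lt/(_ _ e40) := @cvg_stieltjes_sum f M U G FU UG.
apply: filterS => nu; rewrite (Rintegral_distribution _ _ mf fB).
have := stieltjes_sum_circle mf fB fdel' M0 Mdel nu.
have mY : measurable_fun setT (f \o @expi R \o @clamp R : measurableTypeR R -> R).
  by rewrite -compA; apply: measurableT_comp => //; exact: measurable_expi_clamp.
have := stieltjes_sum_line fB fdel' M0 Mdel (And3 ndr rG0 rG1) PG mY.
have := stieltjes_sum_right_limit fdel' M0 Mdel cG.
rewrite /=; set x1 := stieltjes_sum _ _ _; set x2 := stieltjes_sum _ _ _.
set x3 := stieltjes_sum _ _ _; set x4 := Rintegral _ _ _; set x5 := Rintegral _ _ _.
by rewrite !ler_norml !ltr_norml; lra.
Qed.

End prob_compact.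

(** * Baire category, and invariance as a closed condition *)

Section baire.
Variable T : topologicalType.

(** The usual shrinking construction: regularity yields open sets meeting P whose
    closures are nested inside the successive [O n], and compactness a common
    point of these closures. *)
Lemma compact_regular_baire (P U : set T) (O : nat -> set T) :
  compact [set: T] -> regular_space T -> closed P -> (forall n, open (O n)) ->
  (forall n V, open V -> V `&` P !=set0 -> V `&` O n `&` P !=set0) ->
  open U -> U `&` P !=set0 -> exists x, [/\ P x, U x & forall n, O n x].
Proof.
move=> cT rT cP oO dO oU UP.
have step (n : nat) (V : set T) : exists W : set T, open V -> V `&` P !=set0 ->
    [/\ open W, W `&` P !=set0 & closure W `<=` V `&` O n].
  have [[oV VP]|nV] := pselect (open V /\ V `&` P !=set0); last first.
    by exists set0 => oV VP; case: nV.
  have [x [VOx Px]] := dO n V oV VP.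
  have : nbhs x (V `&` O n) by apply: open_nbhs_nbhs; split => //; exact: openI.
  move=> /rT[B Bx BVO]; exists (interior B) => _ _; split.
  - exact: open_interior.
  - by exists x.
  - by apply: subset_trans BVO; apply: closureS; exact: interior_subset.
have [st stP] := boolp.choice (fun nV => step nV.1 nV.2).
pose V := fix V n := if n is n'.+1 then st (n', V n') else U.
have VP n : open (V n) /\ V n `&` P !=set0.
  elim: n => [//|n [oVn VPn]] /=.
  by have [? ? _] := stP (n, V n) oVn VPn.
have VS n : closure (V n.+1) `<=` V n `&` O n.
  by have [oVn VPn] := VP n; have [] := stP (n, V n) oVn VPn.
have Vle m n : (m <= n)%N -> V n `<=` V m.
  elim: n => [|n IHn]; first by rewrite leqn0 => /eqP ->.
  rewrite leq_eqVlt => /orP[/eqP -> //|]; rewrite ltnS => /IHn; apply: subset_trans.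
  by move=> x Vx; have [] := VS n x (subset_closure Vx).
pose F := filter_from [set: nat] (fun n => V n `&` P).
have FF : ProperFilter F.
  apply: filter_from_proper => [|n _]; last by have [] := VP n.
  apply: filter_from_filter; first by exists 0%N.
  move=> m n _ _; exists (maxn m n) => // x [Vx Px].
  by split; split => //; apply: Vle Vx; [exact: leq_maxl|exact: leq_maxr].
have [x [_ Fx]] := cT F FF filterT.
have Vx n : closure (V n) x.
  by move=> A Ax; apply: Fx => //; exists n => // y [].
exists x; split.
- by apply: cP => A Ax; apply: Fx => //; exists 0%N => // y [].
- by have [] := VS 0%N x (Vx 1%N).
- by move=> n; have [] := VS n x (Vx n.+1).
Qed.

End baire.

Section prob_separation.
Variable R : realType.
Implicit Types (mu nu : prob R) (f : circle R -> R).

(** An initial topology with values in a uniform space is uniformizable. *)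
Lemma regular_prob : regular_space (prob R).
Proof. exact: (@uniform_regular (initial_topology (@integral_eval R))). Qed.

(** Measures of closed and open sets are compared through an Urysohn function,
    which is the same for all measures. *)
Lemma urysohn_integral (K O : set (circle R)) : closed K -> open O -> K `<=` O ->
  exists2 f : circle R -> R, continuous f &
    forall mu, fine (mu K) <= \int[mu]_z f z <= fine (mu O).
Proof.
move=> cK oO KO.
have nT : normal_space (circle R).
  by apply: compact_normal; [exact: circle_hausdorff|exact: circle_compact].
move/(normal_separatorP (R := R)) : nT => nT.
have KO0 : ~` O `&` K = set0.
  by rewrite -subset0 => z [Oz /KO].
have [f [cf f01 f0 f1]] := (@uniform_separatorP _ R _ _).1 (nT _ _ (open_closedC oO) cK KO0).
exists f => // mu; have mf := continuous_circle_measurable cf.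
have f0' z : 0 <= f z <= 1.
  by have := f01 (f z); rewrite /= in_itv /=; apply; exists z.
have fB z : `|f z| <= 1 by have /andP[? ?] := f0' z; rewrite ger0_norm.
have indB (A : set (circle R)) z : `|\1_A z| <= 1 :> R.
  by rewrite indicE; case: (_ \in _); rewrite ?normr1 ?normr0.
have ind (A : set (circle R)) : measurable A -> \int[mu]_z \1_A z = fine (mu A).
  by move=> mA; rewrite /Rintegral integral_indic// setIT.
have Iind (A : set (circle R)) : measurable A -> mu.-integrable setT (EFin \o \1_A).
  by move=> mA; apply: (bounded_integrable mu _ (indB A)); exact: measurable_indic.
have If := bounded_integrable mu mf fB.
have mK := closed_circle_measurable cK; have mO := open_circle_measurable oO.
rewrite -(ind _ mK) -(ind _ mO); apply/andP; split; apply: le_Rintegral => //;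
  try exact: Iind; try exact: If.
- move=> z _; rewrite indicE; have /andP[fz0 _] := f0' z; case: (boolP (z \in K)) => [|//].
  by move=> /set_mem Kz; have -> : f z = 1 by apply: f1; exists z.
- move=> z _; rewrite indicE; have /andP[_ fz1] := f0' z; case: (boolP (z \in O)) => [//|].
  by move=> /negP; rewrite inE => Oz; have -> : f z = 0 by apply: f0; exists z.
Qed.

(** O is the increasing union of closed sets K, and an Urysohn function squeezed
    between K and O gives mu K <= nu O. *)
Lemma le_open_measure mu nu :
  (forall f, continuous f -> \int[mu]_z f z = \int[nu]_z f z) ->
  forall O, open O -> (mu O <= nu O)%E.
Proof.
move=> H O oO.
pose K (n : nat) := [set z | forall w, ~ O w -> n.+1%:R^-1 <= cdist w z].
have cK n : closed (K n).
  have -> : K n = \bigcap_(w in ~` O) ((cdist w) @^-1` [set x | n.+1%:R^-1 <= x]).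
    by apply/seteqP; split.
  apply: closed_bigI => w _; apply: closed_comp => [z _|]; first exact: cdist_continuous.
  exact: closed_ge.
have KO n : K n `<=` O.
  move=> z Kz; apply: contrapT => /Kz; rewrite cdistzz leNgt; apply/negP/negPn.
  by rewrite invr_gt0.
have KU : \bigcup_n K n = O.
  apply/seteqP; split => [z [n _] /KO//|z Oz].
  have [r r0 rO] : exists2 r : R, 0 < r & forall w, cdist z w < r -> O w.
    by apply: nbhs_cdistP; exact: open_nbhs_nbhs.
  exists (Num.truncn r^-1) => // w Ow; rewrite cdistC leNgt; apply/negP => zw.
  apply/Ow/rO; apply: lt_trans zw _; rewrite invf_plt ?posrE ?ltr0n//.
  exact: truncnS_gt.
have ndK : nondecreasing_seq K.
  move=> m n mn; apply/subsetPset => z Kz w /Kz; apply: le_trans.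
  by rewrite lef_pV2 ?posrE ?ltr0n// ler_nat.
have := @nondecreasing_cvg_mu _ _ _ mu K (fun n => closed_circle_measurable (cK n)).
rewrite KU => /(_ (open_circle_measurable oO) ndK) muK.
rewrite -(cvg_lim (@ereal_hausdorff R) muK); apply: lime_le.
  by apply/cvg_ex; exists (mu O).
apply: nearW => n /=; have [f cf Hf] := urysohn_integral (cK n) oO (KO n).
have mK := closed_circle_measurable (cK n); have mO := open_circle_measurable oO.
rewrite -(fineK (fin_prob mu mK)) -(fineK (fin_prob nu mO)) lee_fin.
by have /andP[+ _] := Hf mu; have /andP[_] := Hf nu; rewrite (H f cf); lra.
Qed.

Lemma prob_eq_of_integral mu nu :
  (forall f, continuous f -> \int[mu]_z f z = \int[nu]_z f z) ->
  forall C : set (circle R), measurable C -> mu C = nu C.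
Proof.
move=> H; apply: (g_sigma_algebra_measure_unique (@open (circle R)) _ (fun=> setT)).
- by move=> A oA; exact: open_circle_measurable.
- by move=> _; exact: openT.
- by rewrite bigcup_const.
- by move=> A B; exact: openI.
- move=> A oA; apply/eqP; rewrite eq_le; apply/andP; split; apply: le_open_measure => // f cf.
  by rewrite H.
- by move=> _; rewrite (le_lt_trans (probability_le1 mu measurableT)) ?ltry.
Qed.

Lemma Rintegral_push n mu f : continuous f ->
  \int[push n mu]_z f z = \int[mu]_z f (powc n z).
Proof.
move=> cf; have [B fB] := continuous_circle_bounded cf.
by rewrite (Rintegral_distribution _ _ (continuous_circle_measurable cf) fB).
Qed.

Lemma continuous_comp_powc n f : continuous f -> continuous (f \o @powc R n).
Proof. by move=> cf z; apply: continuous_comp; [exact: continuous_powc|exact: cf]. Qed.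

(** Equations between integrals of continuous functions are closed conditions for
    the weak topology, unlike equations between measures of Borel sets. *)
Lemma invariant_probP p mu : invariant_prob p mu <->
  forall f, continuous f -> \int[mu]_z f (powc p z) = \int[mu]_z f z.
Proof.
split=> [H f cf|H].
  rewrite -Rintegral_push// /Rintegral; congr fine.
  by apply: eq_measure_integral => A mA _; exact: H.
by apply: prob_eq_of_integral => f cf; rewrite Rintegral_push// H.
Qed.

Lemma closed_invariant_prob p : closed (@invariant_prob R p).
Proof.
have -> : @invariant_prob R p = \bigcap_(f in [set f | continuous f])
   ((fun mu => \int[mu]_z f (powc p z) - \int[mu]_z f z : R) @^-1` [set 0]).
  apply/seteqP; split => mu.
    by move=> /invariant_probP H f cf /=; rewrite H// subrr.
  by move=> H; apply/invariant_probP => f cf; apply/eqP; rewrite -subr_eq0; apply/eqP/H.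
apply: closed_bigI => f cf; apply: closed_comp => [mu _|]; last exact: closed_eq.
have c1 := @continuous_prob_integral R _ (continuous_comp_powc (n := p) cf) mu.
have c2 := @continuous_prob_integral R _ cf mu.
exact: (cvgB c1 c2).
Qed.

End prob_separation.

(** * Eventual periodicity of the powers of q modulo p^m - 1 *)

Section arithmetic.
Local Open Scope nat_scope.

(** Split P = p^m - 1 into its part P1 composed of primes dividing q and the
    complementary part P2.  As q is a unit modulo P2, q^n = 1 modulo P2 for
    all multiples n of phi(P2).  It remains that P1 divides q^p for
    m = 1 + L t, where L = phi(Q) and Q is the part of q^p prime to p: modulo
    Q, hence modulo l^p for every prime l dividing q but not p, one has
    p^m = p, so l^p dividing p^m - 1 would force l^p to divide p - 1 < l^p. *)
Lemma expn_sub1_eventual_period p q : 2 <= p -> 2 <= q ->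
  exists2 L, 0 < L & forall t N, exists2 n, N <= n &
    q ^ (p + n) = q ^ p %[mod p ^ (L * t).+1 - 1].
Proof.
move=> hp hq; have p0 : 0 < p by lia.
have q0 : 0 < q by lia.
have qp0 : 0 < q ^ p by rewrite expn_gt0 q0.
(* The exponent p of q^p is the bound on the l-adic valuations of p^m - 1. *)
pose Q := (q ^ p)`_(\pi(p)^').
have cpQ : coprime p Q.
  by apply: (@pnat_coprime \pi(p)); rewrite ?part_pnat// pnat_pi.
exists (totient Q) => [|t N]; first by rewrite totient_gt0 part_gt0.
set m := (_ * t).+1; set P := p ^ m - 1.
have pm : p <= p ^ m by rewrite -{1}(expn1 p) leq_pexp2l.
have P0 : 0 < P by rewrite subn_gt0 (leq_trans hp).
have pmQ : p ^ m = p %[mod Q].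
  rewrite /m expnS expnM -modnMmr -modnXm Euler_exp_totient//.
  by rewrite modnXm exp1n modnMmr muln1.
pose P1 := P`_\pi(q); pose P2 := P`_(\pi(q)^').
have PE : P = P1 * P2 by rewrite partnC.
have P1q : P1 %| q ^ p.
  apply/dvdn_partP; first by rewrite part_gt0.
  move=> l lP1; have lpr : prime l by move: lP1; rewrite mem_primes => /andP[].
  have lq : l %| q.
    have : l \in \pi(q) by apply: (pnatPpi (part_pnat \pi(q) P)).
    by rewrite mem_primes => /and3P[].
  have lP : l %| P.
    move: lP1; rewrite mem_primes => /and3P[_ _ lP1].
    by rewrite PE dvdn_mulr.
  have lp : ~~ (l %| p).
    apply/negP => lp; have : l %| p ^ m by rewrite dvdn_exp.
    have -> : p ^ m = P + 1 by rewrite subnK // (leq_trans _ pm)// ltnW.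
    by rewrite dvdn_addr// dvdn1 => /eqP l1; rewrite l1 in lpr.
  rewrite p_part; suff logP : logn l P1 <= p.
    by apply: dvdn_trans (dvdn_exp2l l logP) _; rewrite dvdn_exp2r.
  rewrite leqNgt; apply/negP => logP.
  have lpP : l ^ p %| P.
    by rewrite PE dvdn_mulr// pfactor_dvdn ?part_gt0// ltnW.
  have lpQ : l ^ p %| Q.
    rewrite -(@Gauss_dvdr _ (q ^ p)`_\pi(p)) ?partnC ?dvdn_exp2r//.
    rewrite coprime_sym; apply: (@pnat_coprime \pi(p)); first exact: part_pnat.
    by rewrite pnatX pnatE// inE /= mem_primes lpr p0 (negPf lp).
  have : p = 1 %[mod l ^ p].
    have <- : p ^ m = 1 %[mod l ^ p].
      by apply/eqP; rewrite eqn_mod_dvd ?(leq_trans _ pm)// ltnW.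
    apply/esym/eqP; rewrite eqn_mod_dvd// (dvdn_trans lpQ)// -eqn_mod_dvd//.
    exact/eqP.
  move/eqP; rewrite eqn_mod_dvd// => /dvdn_leq; rewrite subn_gt0 hp => /(_ isT).
  move=> le_lp; have lt_lp := ltn_expl p (prime_gt1 lpr).
  by have := leq_trans lt_lp (leq_trans le_lp (leq_subr 1 p)); rewrite ltnn.
have : coprime q P2 by apply: (@pnat_coprime \pi(q)); rewrite ?part_pnat// pnat_pi.
move=> /Euler_exp_totient qP2.
exists (totient P2 * N).
  by rewrite leq_pmull// totient_gt0 part_gt0.
have qn0 : 0 < q ^ (totient P2 * N) by rewrite expn_gt0 q0.
apply/eqP; rewrite eqn_mod_dvd ?leq_pexp2l ?leq_addr//.
rewrite expnD -{2}(muln1 (q ^ p)) -mulnBr PE dvdn_mul//.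
by rewrite -eqn_mod_dvd// expnM -modnXm qP2 modnXm exp1n.
Qed.

End arithmetic.

(** * Periodic points near every point of the circle *)

Section nearest_point.
Variable R : realType.
Implicit Types (z w : circle R) (s : seq (circle R)) (r : R).

(** Searching a finite list makes the choice of a nearby point measurable in z. *)
Definition nearest s r z : circle R := nth point s (find (fun w => cdist w z <= r) s).

Lemma measurable_nearest s r : measurable_fun setT (nearest s r).
Proof.
elim: s => [|w s IHs].
  rewrite (_ : nearest [::] r = cst point)//; exact: measurable_cst.
rewrite (_ : nearest (w :: s) r = fun z => if cdist w z <= r then w else nearest s r z).
  apply: measurable_fun_ifT => //.
  apply: measurable_fun_ler => //.
  by apply: continuous_circle_measurable; exact: cdist_continuous.
by apply/funext => z; rewrite /nearest /=; case: ifP.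
Qed.

HB.instance Definition _ s r :=
  isMeasurableFun.Build _ _ _ _ (nearest s r) (measurable_nearest s r).

Lemma nearestP s r z : (exists2 w, w \in s & cdist w z <= r) ->
  nearest s r z \in s /\ cdist (nearest s r z) z <= r.
Proof.
move=> [w ws wz]; have hs : has (fun w => cdist w z <= r) s by apply/hasP; exists w.
by split; [rewrite mem_nth// -has_find|exact: (nth_find point hs)].
Qed.

End nearest_point.

Section periodic_points.
Variables (R : realType) (p : nat).
Hypothesis hp : (2 <= p)%N.
Implicit Types (z w : circle R) (m n k : nat).

Lemma expi_nat n : expi n%:R = point :> circle R.
Proof. by rewrite -[n%:R]mulr1 -powc_expi expi1 powc_point. Qed.

Lemma powc_eq_point n (x : R) : powc n.+1 (expi x) = expi x -> expi (n%:R * x) = point.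
Proof.
rewrite powc_expi -natr1 mulrDl mul1r => H; apply: val_inj.
have := congr1 val H; rewrite expiD => /(congr1 (fun c => c / val (expi x))).
have x0 : val (expi x) != 0 by rewrite -normr_eq0 (eqP (valP (expi x))) oner_eq0.
by rewrite mulfK// divff.
Qed.

(** Solutions of w^(p^m) = w with the fixed points of z |-> z^p removed.  For m
    prime, all remaining points have exact period m.  The index k runs past
    p^m - 1 so that the next grid point after any point of [0, 1] is listed. *)
Definition periodic_points m : seq (circle R) :=
  [seq z <- [seq expi (k%:R / (p ^ m - 1)%:R) | k <- iota 0 (p ^ m).+1] |
    powc p z != z].

Let P m : R := (p ^ m - 1)%:R.

Lemma pow_sub1_gt0 m : (0 < m)%N -> 0 < P m.
Proof. by move=> m0; rewrite ltr0n subn_gt0 -(exp1n m) ltn_exp2r. Qed.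

Lemma periodic_points_root m z : (0 < m)%N -> z \in periodic_points m ->
  powc (p ^ m - 1) z = point.
Proof.
move=> m0; rewrite mem_filter => /andP[_ /mapP[k _ ->]].
by rewrite powc_expi mulrC divfK ?expi_nat// gt_eqF// pow_sub1_gt0.
Qed.

Lemma periodic_points_nonfixed m z : z \in periodic_points m -> powc p z != z.
Proof. by rewrite mem_filter => /andP[]. Qed.

(** The candidates are the two grid points surrounding z.  They cannot both be
    fixed by z |-> z^p, for then their quotient, the primitive root of unity of
    order p^m - 1, would satisfy w^(p-1) = 1. *)
Lemma periodic_points_dense m z : (2 <= m)%N ->
  exists2 w, w \in periodic_points m & cdist w z <= 4 * pi / P m.
Proof.
move=> m2; have P0 : 0 < P m by rewrite pow_sub1_gt0// ltnW.
have [x /andP[x0 x1] <-] := expi_surj z.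
pose k := Num.truncn (x * P m).
have /andP[kx xk] : k%:R <= x * P m < k.+1%:R by rewrite truncn_itv// mulr_ge0// ltW.
have kP : (k <= p ^ m - 1)%N.
  by rewrite -(ler_nat R) (le_trans kx)// -/(P m) ler_piMl// ltW.
have pm0 : (0 < p ^ m)%N by rewrite expn_gt0; lia.
have close j : (k <= j <= k.+1)%N -> cdist (expi (j%:R / P m)) (expi x) <= 4 * pi / P m.
  move=> /andP[kj jk]; apply: le_trans (expi_lip _ _) _.
  rewrite ler_pM2l ?mulr_gt0 ?pi_gt0//.
  have -> : x = x * P m / P m by rewrite mulfK// gt_eqF.
  rewrite -mulrBl normrM normfV (gtr0_norm P0) ler_piMl ?invr_ge0 ?(ltW P0)//.
  have {kj}: k%:R <= j%:R :> R by rewrite ler_nat.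
  have {jk}: j%:R <= k%:R + 1 :> R by rewrite natr1 ler_nat.
  by move: xk; rewrite -natr1 ler_norml; lra.
have mem j : (k <= j <= k.+1)%N ->
    powc p (expi (j%:R / P m)) != expi (j%:R / P m) :> circle R ->
    (expi (j%:R / P m) : circle R) \in periodic_points m.
  move=> /andP[kj jk] nf; rewrite mem_filter nf; apply/mapP; exists j => //.
  by rewrite mem_iota; lia.
have [fk|nfk] := eqVneq (powc p (expi (k%:R / P m)) : circle R)
  (expi (k%:R / P m)); last first.
  by exists (expi (k%:R / P m)); [apply: mem|apply: close]; rewrite // leqnn leqnSn.
have [fk1|nfk1] := eqVneq (powc p (expi (k.+1%:R / P m)) : circle R)
  (expi (k.+1%:R / P m)); last first.
  by exists (expi (k.+1%:R / P m)); [apply: mem|apply: close]; rewrite // leqnn leqnSn.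
exfalso; have pE : p = p.-1.+1 by lia.
rewrite pE in fk fk1.
have := powc_eq_point fk; have := powc_eq_point fk1.
rewrite -natr1 mulrDl mulrDr => /(congr1 val); rewrite expiD => /[swap] -> /=.
rewrite mul1r -/(val (expi _)) => H.
apply: (@expi_neq1 R (p.-1%:R * (1 / P m))).
  rewrite mul1r; apply/andP; split; first by rewrite divr_gt0// ltr0n; lia.
  rewrite ltr_pdivrMr// mul1r ltr_nat.
  have : (p ^ 2 <= p ^ m)%N by rewrite leq_pexp2l//; lia.
  by rewrite expnS expn1; have := leq_mul hp (leqnn p); lia.
exact: val_inj.
Qed.

End periodic_points.

(** * Approximation by orbit measures *)

Section orbit_measures.
Variables (R : realType) (p : nat).
Hypothesis hp : (2 <= p)%N.
Implicit Types (z w : circle R) (m n k : nat) (mu : prob R) (f : circle R -> R).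

Definition periodic_proj m : {mfun circle R >-> circle R} :=
  nearest (periodic_points R p m) (4 * pi / (p ^ m - 1)%:R).

Lemma periodic_projP m z : (2 <= m)%N ->
  periodic_proj m z \in periodic_points R p m /\
  cdist (periodic_proj m z) z <= 4 * pi / (p ^ m - 1)%:R.
Proof. by move=> m2; apply: nearestP; exact: periodic_points_dense. Qed.

(** [average] takes the number of terms minus one, so this is an average of m terms
    when m > 0. *)
Definition orbit_measure m mu : prob R :=
  average m.-1 (fun i => push (p ^ i) (distribution mu (periodic_proj m)) : probability _ R).

Lemma Rintegral_orbit_measure m mu f : (0 < m)%N -> continuous f ->
  \int[orbit_measure m mu]_z f z =
  m%:R^-1 * \sum_(i < m) \int[mu]_z f (powc (p ^ i) (periodic_proj m z)).
Proof.
case: m => // m _ cf; have mf := continuous_circle_measurable cf.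
have [B fB] := continuous_circle_bounded cf.
rewrite (Rintegral_average _ _ mf fB) /=; congr (_ * _); apply: eq_bigr => i _.
rewrite Rintegral_push// (Rintegral_distribution _ _ _ (fun z => fB _))//.
exact: continuous_circle_measurable (continuous_comp_powc _).
Qed.

Lemma periodic_proj_period m z : (2 <= m)%N ->
  powc (p ^ m) (periodic_proj m z) = periodic_proj m z.
Proof.
move=> m2; have [/(periodic_points_root hp) H _] := periodic_projP z m2.
have pm : (p ^ m = 1 + (p ^ m - 1))%N by rewrite subnKC// expn_gt0; lia.
rewrite pm; apply: val_inj; rewrite /= exprD.
by have /(congr1 val) /= -> := H (ltnW m2); rewrite mulr1 expr1.
Qed.

Lemma orbit_measure_invariant m mu : (2 <= m)%N -> invariant_prob p (orbit_measure m mu).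
Proof.
move=> m2; apply/invariant_probP => f cf; have m0 : (0 < m)%N by lia.
rewrite (Rintegral_orbit_measure mu m0 (continuous_comp_powc cf)).
rewrite (Rintegral_orbit_measure mu m0 cf); congr (_ * _); apply/eqP.
rewrite -subr_eq0 -sumrB; apply/eqP.
pose u i := \int[mu]_z f (powc (p ^ i) (periodic_proj m z)).
rewrite (eq_bigr (fun i : 'I_m => u i.+1 - u i)) => [|i _].
  rewrite -(big_mkord xpredT (fun i => u i.+1 - u i)) telescope_sumr// /u.
  apply/eqP; rewrite subr_eq0; apply/eqP; apply: eq_Rintegral => z _.
  by rewrite periodic_proj_period// expn0 powc1.
by congr (_ - _); apply: eq_Rintegral => z _ /=; rewrite powc_comp expnS.
Qed.

(** The displacement is at most 4 pi / (p^m - 1) <= 8 pi / p^m, and is multiplied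
    by at most p^(m - K) <= p^m / 2^K. *)
Lemma orbit_close (K i m : nat) (del : R) :
  8 * pi / 2 ^+ K < del -> (0 < m)%N -> (i + K <= m)%N ->
  (p ^ i)%:R * (4 * pi / (p ^ m - 1)%:R) < del.
Proof.
move=> Kdel m0 iKm; apply: le_lt_trans Kdel.
have pi0 := pi_gt0 R.
have P0 := pow_sub1_gt0 R hp m0.
have pm : (p ^ m <= 2 * (p ^ m - 1))%N.
  have : (p ^ 1 <= p ^ m)%N by rewrite leq_pexp2l//; lia.
  by rewrite expn1; lia.
have piK : (p ^ i * 2 ^ K <= p ^ m)%N.
  apply: (@leq_trans (p ^ i * p ^ K)); last first.
    by rewrite -expnD leq_pexp2l//; lia.
  have pK : (2 ^ K <= p ^ K)%N by case: (K) => [|k] //; rewrite leq_exp2r.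
  by rewrite leq_mul2l pK orbT.
have : (p ^ i * 2 ^ K <= 2 * (p ^ m - 1))%N by lia.
rewrite -(ler_nat R) !natrM !natrX => H.
rewrite ler_pdivlMr ?exprn_gt0//.
rewrite mulrA mulrAC ler_pdivrMr//.
have pi4 : 0 <= 4 * pi :> R by rewrite mulr_ge0// ltW.
by have := ler_wpM2l pi4 H; lra.
Qed.

(** Invariance of mu writes its integral as the average of the integrals of
    f (z^(p^i)).  The terms with i + K <= m differ from those of the orbit
    measure by at most e / 2; the K last ones by at most 2 B, which is
    negligible after division by m. *)
Lemma orbit_measure_near mu f (e : R) : invariant_prob p mu -> continuous f -> 0 < e ->
  \forall m \near \oo, `|\int[orbit_measure m mu]_z f z - \int[mu]_z f z| <= e.
Proof.
move=> /invariant_probP inv cf e0; have mf := continuous_circle_measurable cf.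
have [B fB] := continuous_circle_bounded cf.
have B0 : 0 <= B by apply: le_trans (fB point).
have e20 : 0 < e / 2 by rewrite divr_gt0.
have [del del0 fdel] := continuous_circle_unif cf e20.
have [K Kdel] : exists K, 8 * pi / 2 ^+ K < del :> R.
  exists (Num.truncn (8 * pi / del)).+1.
  rewrite ltr_pdivrMr ?exprn_gt0// (mulrC del) -ltr_pdivrMr//.
  apply: lt_le_trans (truncnS_gt _) _; rewrite -natrX ler_nat.
  by apply: ltnW; apply: ltn_expl.
near=> m.
have m2 : (2 <= m)%N by near: m; exact: nbhs_infty_ge.
have m0 : (0 < m)%N by lia.
have mr0 : 0 < m%:R :> R by rewrite ltr0n.
have Km : (K <= m)%N by near: m; exact: nbhs_infty_ge.
have KBm : 4 * B * K%:R / e <= m%:R by near: m; exact: nbhs_infty_ger.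
rewrite (Rintegral_orbit_measure mu m0 cf).
pose D i := \int[mu]_z f (powc (p ^ i) (periodic_proj m z)) - \int[mu]_z f z.
have invi i : \int[mu]_z f (powc (p ^ i) z) = \int[mu]_z f z.
  elim: i => [|i IHi]; first by apply: eq_Rintegral => z _; rewrite expn0 powc1.
  rewrite -IHi -(inv _ (continuous_comp_powc (n := p ^ i) cf)).
  by apply: eq_Rintegral => z _ /=; rewrite powc_comp expnSr.
have -> : m%:R^-1 * \sum_(i < m) \int[mu]_z f (powc (p ^ i) (periodic_proj m z)) -
    \int[mu]_z f z = m%:R^-1 * \sum_(i < m) D i.
  rewrite /D sumrB big_const_ord iter_addr_0 mulrBr -[X in _ - _ * X]mulr_natl.
  by rewrite mulKf// gt_eqF.
rewrite normrM ger0_norm ?invr_ge0 ?(ltW mr0)// mulrC ler_pdivrMr//.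
apply: le_trans (ler_norm_sum _ _ _) _.
have DB i : `|D i| <= (if (i + K <= m)%N then e / 2 else 2 * B).
  rewrite /D -(invi i); apply: (@le_Rintegral_dist _ _ _ mu _ _ B).
  - exact: measurableT_comp (continuous_circle_measurable (continuous_comp_powc cf)) _.
  - exact: continuous_circle_measurable (continuous_comp_powc cf).
  - by move=> z.
  - move=> z; case: ifP => iK.
      apply/ltW/fdel; apply: le_lt_trans (powc_lip _ _ _) _.
      apply: le_lt_trans (orbit_close Kdel m0 iK); rewrite ler_wpM2l//.
      by have [] := periodic_projP z m2.
    have := fB (powc (p ^ i) (periodic_proj m z)); have := fB (powc (p ^ i) z).
    by rewrite !ler_norml; lra.
apply: (@le_trans _ _ (\sum_(i < m) (if (i + K <= m)%N then e / 2 else 2 * B))).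
  by apply: ler_sum => i _; exact: DB.
rewrite -(big_mkord xpredT (fun i => if (i + K <= m)%N then e / 2 else 2 * B)).
rewrite (@big_cat_nat _ _ _ (m - K)%N)//=; last by rewrite leq_subr.
apply: (@le_trans _ _ (\sum_(0 <= i < m - K) (e / 2) +
  \sum_(m - K <= i < m) (2 * B + e / 2))).
  apply: lerD; rewrite big_nat_cond [leRHS]big_nat_cond; apply: ler_sum => i.
    by rewrite andbT => /andP[_ im]; rewrite ifT//; lia.
  by move=> _; case: ifP => _; lra.
rewrite !sumr_const_nat subn0 subKn//.
rewrite -[e / 2 *+ _]mulr_natr -[(_ + e / 2) *+ _]mulr_natr natrB//.
have : 4 * B * K%:R <= m%:R * e by rewrite -ler_pdivrMr.
by lra.
Unshelve. all: by end_near. Qed.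

End orbit_measures.

Section orbit_measures_properties.
Variables (R : realType) (p : nat).
Hypothesis hp : (2 <= p)%N.
Implicit Types (z w : circle R) (m n k : nat) (mu : prob R) (f : circle R -> R).

Lemma orbit_measure_cvg mu : invariant_prob p mu ->
  orbit_measure p m mu @[m --> \oo] --> mu.
Proof.
move=> inv; apply/cvg_prob => f cf; apply/cvgrPdist_le => e e0.
by near do rewrite distrC; exact: orbit_measure_near.
Unshelve. all: by end_near. Qed.

Lemma powc_iter_period m z j : powc (p ^ m) z = z -> powc (p ^ (j * m)) z = z.
Proof.
move=> H; elim: j => [|j IHj]; first by rewrite mul0n expn0 powc1.
by rewrite mulSn expnD -powc_comp IHj.
Qed.

(** If two iterates agreed, w would have both periods m and j - i, which are
    coprime, hence period 1. *)
Lemma powc_prime_period m z i j : prime m -> powc (p ^ m) z = z -> powc p z <> z ->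
  (i < j < m)%N -> powc (p ^ i) z <> powc (p ^ j) z.
Proof.
move=> mpr zm zp /andP[ij jm] E; apply: zp.
have H : powc (p ^ (j - i)) z = z.
  have := congr1 (powc (p ^ (m - i))) E; rewrite !powc_comp -!expnD.
  rewrite subnK; last by lia.
  have -> : (m - i + j = (j - i) + m)%N by lia.
  by rewrite zm expnD -powc_comp zm => <-.
have cop : coprime m (j - i).
  rewrite prime_coprime//; apply/negP => /dvdn_leq; lia.
have m0 : (0 < m)%N by exact: prime_gt0.
case: (egcdnP (j - i) m0) => u v Huv _; rewrite (eqP cop) in Huv.
have := powc_iter_period u zm; rewrite Huv addn1 expnS -powc_comp.
by rewrite (powc_iter_period v H).
Qed.

(** The events that the i-th iterate of the displaced point equals y are disjoint,
    so their masses add up to at most 1. *)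
Lemma orbit_measure_atom m mu y : prime m ->
  (orbit_measure p m mu [set y] <= (m%:R^-1)%:E)%E.
Proof.
move=> mpr; have m2 := prime_gt1 mpr; have m0 : (0 < m)%N by lia.
have my : measurable [set y].
  apply: closed_circle_measurable; apply: compact_closed; first exact: circle_hausdorff.
  exact: compact_set1.
pose A i := periodic_proj R p m @^-1` (powc (p ^ i) @^-1` [set y]).
have mA i : measurable (A i).
  rewrite -[A i]setTI; apply: measurable_funPT => //.
  by rewrite -[X in measurable X]setTI; apply: measurable_powc.
have mpred : m = m.-1.+1 by rewrite prednK.
have -> : orbit_measure p m mu [set y] = ((m%:R^-1)%:E * \sum_(i < m) mu (A i))%E.
  by rewrite [in RHS]mpred.
rewrite -[leRHS]mule1 lee_pmul2l//; last by rewrite lte_fin invr_gt0 ltr0n.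
rewrite -(@measure_bigsetU_ord _ _ _ mu m xpredT (fun i => A i))//.
  by apply: probability_le1; exact: bigsetU_measurable.
apply/trivIsetP => -[i im] [j jm] _ _ /= ij.
rewrite -subset0 => z [/= zi zj].
have [zp _] := periodic_projP hp z m2.
have nfix : powc p (periodic_proj R p m z) <> periodic_proj R p m z.
  exact/eqP/(periodic_points_nonfixed zp).
have per := periodic_proj_period hp z m2.
have [lt|gt|E] := ltngtP i j; last by move: ij; rewrite -val_eqE /= E eqxx.
  by apply: (powc_prime_period (i := i) (j := j) mpr per nfix); rewrite ?lt// zi zj.
by apply: (powc_prime_period (i := j) (j := i) mpr per nfix); rewrite ?gt// zi zj.
Qed.

Definition ReX (n : nat) z : R := complex.Re (val (powc n z)).
Definition ImX (n : nat) z : R := complex.Im (val (powc n z)).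

Lemma fourierE mu n :
  fourier mu n%:Z = (\int[mu]_z ReX n z) +i* (\int[mu]_z ImX n z).
Proof. by []. Qed.

Lemma Re_cdist z w : `|complex.Re (val z) - complex.Re (val w)| <= cdist z w.
Proof.
rewrite /cdist; case: (val z) => a b; case: (val w) => c d /=.
by rewrite -sqrtr_sqr ler_wsqrtr// lerDl sqr_ge0.
Qed.

Lemma Im_cdist z w : `|complex.Im (val z) - complex.Im (val w)| <= cdist z w.
Proof.
rewrite /cdist; case: (val z) => a b; case: (val w) => c d /=.
by rewrite -sqrtr_sqr ler_wsqrtr// lerDr sqr_ge0.
Qed.

Lemma continuous_ReX n : continuous (ReX n).
Proof.
apply: (@continuous_comp_powc R n (fun z => complex.Re (val z))).
apply: continuous_from_circle => z e e0; exists e => // w.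
exact: le_lt_trans (Re_cdist _ _).
Qed.

Lemma continuous_ImX n : continuous (ImX n).
Proof.
apply: (@continuous_comp_powc R n (fun z => complex.Im (val z))).
apply: continuous_from_circle => z e e0; exists e => // w.
exact: le_lt_trans (Im_cdist _ _).
Qed.

Lemma powc_modn n k l z : powc n z = point -> k = l %[mod n] -> powc k z = powc l z.
Proof.
move=> zn kl; apply: val_inj; have H : val z ^+ n = 1 by exact: (congr1 val zn).
by rewrite /= -(expr_mod k H) kl expr_mod.
Qed.

(** The measure is carried by the roots of unity of order p^m - 1. *)
Lemma fourier_orbit_measure m mu k l : (2 <= m)%N -> k = l %[mod p ^ m - 1] ->
  fourier (orbit_measure p m mu) k%:Z = fourier (orbit_measure p m mu) l%:Z.
Proof.
move=> m2 kl; have m0 : (0 < m)%N by lia.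
have H i z : powc k (powc (p ^ i) (periodic_proj R p m z)) =
    powc l (powc (p ^ i) (periodic_proj R p m z)).
  have [zp _] := periodic_projP hp z m2.
  apply: (@powc_modn (p ^ m - 1)) => //.
  by rewrite powc_comp mulnC -powc_comp (periodic_points_root hp m0 zp) powc_point.
rewrite !fourierE; congr (_ +i* _).
  rewrite !(Rintegral_orbit_measure p mu m0 (@continuous_ReX _)).
  by congr (_ * _); apply: eq_bigr => i _; apply: eq_Rintegral => z _; rewrite /ReX H.
rewrite !(Rintegral_orbit_measure p mu m0 (@continuous_ImX _)).
by congr (_ * _); apply: eq_bigr => i _; apply: eq_Rintegral => z _; rewrite /ImX H.
Qed.

End orbit_measures_properties.

(** * Open conditions on measures *)

Section small_atoms.
Variable R : realType.
Implicit Types (z w : circle R) (mu : prob R).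

Definition atoms_below (c : R) : set (prob R) :=
  [set mu | forall z, (mu [set z] < c%:E)%E].

Lemma closed_circle_set1 z : closed [set z].
Proof. by apply: compact_closed; [exact: circle_hausdorff|exact: compact_set1]. Qed.

Lemma measurable_circle_set1 z : measurable [set z].
Proof. by apply: closed_circle_measurable; exact: closed_circle_set1. Qed.

Lemma open_cdist_ball z (r : R) : open [set w | cdist z w < r].
Proof.
have /continuousP H := @cdist_continuous R z.
exact: (H [set x | x < r] (@open_lt R r)).
Qed.

Lemma closed_cdist_ball z (r : R) : closed [set w | cdist z w <= r].
Proof.
apply: (@closed_comp _ _ (cdist z) [set x | x <= r]) => [w _|].
  exact: cdist_continuous.
exact: closed_le.
Qed.

(** Continuity of mu along the balls that shrink to z. *)
Lemma ball_measure_lt mu z (c : R) : (mu [set z] < c%:E)%E ->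
  exists2 r : R, 0 < r & (mu [set w | (cdist z w < r)%R] < c%:E)%E.
Proof.
move=> muz; pose O (n : nat) := [set w | cdist z w < n.+1%:R^-1].
have OE : \bigcap_n O n = [set z].
  apply/seteqP; split => [w Ow|w -> n _]; last by rewrite /O /= cdistzz invr_gt0.
  apply/esym/cdist_eq0/eqP; rewrite eq_le cdist_ge0 andbT leNgt; apply/negP => zw.
  have := Ow (Num.truncn (cdist z w)^-1) I; rewrite /O /= ltNge => /negP; apply.
  by apply/ltW; rewrite invf_plt ?posrE ?ltr0n//; exact: truncnS_gt.
have mO n : measurable (O n) by apply: open_circle_measurable; exact: open_cdist_ball.
have niO : nonincreasing_seq O.
  move=> m n mn; apply/subsetPset => w; rewrite /O /= => /lt_le_trans; apply.
  by rewrite lef_pV2 ?posrE ?ltr0n// ler_nat.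
have O0 : (mu (O 0%N) < +oo)%E by rewrite (le_lt_trans (probability_le1 mu (mO 0%N))) ?ltry.
have := @nonincreasing_cvg_mu _ _ _ mu O O0 mO.
rewrite OE => /(_ (measurable_circle_set1 z) niO) muO.
have /muO : nbhs (mu [set z]) [set y | (y < c%:E)%E].
  by apply: open_nbhs_nbhs; split => //; exact: open_ereal_lt_ereal.
by move=> [n _ /(_ n (leqnn n)) muOn]; exists n.+1%:R^-1.
Qed.

(** Near each z, an Urysohn function bounds the atoms of every measure close to mu
    at all points close to z; compactness of the circle makes the
    neighbourhood of mu independent of z. *)
Lemma open_atoms_below (c : R) : open (atoms_below c).
Proof.
rewrite openE => mu muc; rewrite /interior.
suff : nbhs mu (fun nu : prob R => [set: circle R] `<=` [set z | (nu [set z] < c%:E)%E]).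
  by apply: filterS => nu H z; exact: H.
apply: (iffLR (compact_near_coveringP _) (@circle_compact R) _ (nbhs mu)
  (fun (nu : prob R) z => (nu [set z] < c%:E)%E)) => z _.
have [r r0 mur] := ball_measure_lt (muc z).
pose K := [set w | cdist z w <= r / 2]; pose O := [set w | cdist z w < r].
have KO : K `<=` O by move=> w; rewrite /K /O /=; lra.
have cK : closed K by exact: closed_cdist_ball.
have oO : open O by exact: open_cdist_ball.
have [f cf Hf] := urysohn_integral cK oO KO.
have mK := closed_circle_measurable cK; have mO := open_circle_measurable oO.
have fc : \int[mu]_w f w < c.
  have /andP[_ /le_lt_trans] := Hf mu; apply.
  by rewrite -lte_fin fineK// fin_prob.
exists (K, [set nu : prob R | \int[nu]_w f w < c]) => /=.
  split.
    by apply: filterS (near_cdist z (divr_gt0 r0 (ltr0n R 2 : 0 < 2))) => w /ltW.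
  have /(@continuous_prob_integral R f cf mu) : nbhs (\int[mu]_w f w) [set y | y < c].
    by apply: open_nbhs_nbhs; split => //; exact: open_lt.
  by [].
move=> [w nu] [/= Kw nuc].
apply: (@le_lt_trans _ _ (nu K)).
  by apply: le_measure; rewrite ?inE//; [exact: measurable_circle_set1|move=> ? ->].
rewrite -(fineK (fin_prob nu mK)) lte_fin.
by have /andP[/le_lt_trans + _] := Hf nu; apply.
Qed.

End small_atoms.

Section fourier_modulus.
Variable R : realType.
Implicit Types (mu : prob R).

Definition fourier_modulus n mu : R := Normc.normc (fourier mu n%:Z).

Lemma continuous_fourier_modulus n : continuous (fourier_modulus n).
Proof.
move=> mu.
have c1 := @continuous_prob_integral R _ (@continuous_ReX R n) mu.
have c2 := @continuous_prob_integral R _ (@continuous_ImX R n) mu.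
have -> : fourier_modulus n = fun nu =>
    Num.sqrt ((\int[nu]_z ReX n z) ^+ 2 + (\int[nu]_z ImX n z) ^+ 2) by [].
apply: (@cvg_comp _ _ _ _ Num.sqrt _ _ _ _ (@sqrt_continuous R _)).
exact: (cvgD (cvgM c1 c1) (cvgM c2 c2)).
Qed.

End fourier_modulus.

(** * Density of the open conditions *)

Section density.
Variables (R : realType) (p q : nat).
Hypothesis hp : (2 <= p)%N.
Implicit Types (mu : prob R) (V : set (prob R)) (n m k : nat).

Local Notation Pp := (@invariant_prob R p).

Lemma orbit_measure_in V mu : open V -> V mu -> Pp mu ->
  exists N, forall m, (N <= m)%N -> V (orbit_measure p m mu).
Proof.
move=> oV Vmu inv.
have /(orbit_measure_cvg hp inv) : nbhs mu V by exact: open_nbhs_nbhs.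
by move=> [N _ H]; exists N => m Nm; exact: H.
Qed.

Lemma atoms_below_dense V n : open V -> V `&` Pp !=set0 ->
  V `&` atoms_below n.+1%:R^-1 `&` Pp !=set0.
Proof.
move=> oV [mu [Vmu inv]]; have [N HN] := orbit_measure_in oV Vmu inv.
(* A large prime m keeps the approximation in V and makes 1/m < 1/(n+1). *)
have [m mN mpr] := prime_above (N + n.+1).
have m2 := prime_gt1 mpr.
exists (orbit_measure p m mu); split; last exact: orbit_measure_invariant.
split; first by apply: HN; lia.
move=> z; apply: le_lt_trans (orbit_measure_atom hp mu z mpr) _.
by rewrite lte_fin ltf_pV2 ?posrE ?ltr0n ?ltr_nat; lia.
Qed.

Definition nonzero_coef k : set (prob R) := [set mu | fourier_modulus k mu != 0].

Lemma open_nonzero_coef k : open (nonzero_coef k).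
Proof.
have /continuousP H := @continuous_fourier_modulus R k.
exact: (H [set x | x != 0] (@open_neq R 0)).
Qed.

Lemma fourier_modulus_eq0 k mu : fourier_modulus k mu = 0 ->
  \int[mu]_z ReX k z = 0 /\ \int[mu]_z ImX k z = 0.
Proof. by move=> /Normc.eq0_normc; rewrite fourierE => -[]. Qed.

(** [push 0 mu] is the unit mass at 1, which is a fixed point of z |-> z^p; the
    average gives it weight 1/(N+1). *)
Definition add_fixed_mass mu N : prob R :=
  average N (fun i => (if i == 0%N then push 0 mu else mu) : probability _ R).

Lemma Rintegral_add_fixed_mass mu N f : continuous f ->
  \int[add_fixed_mass mu N]_z f z =
  N.+1%:R^-1 * (f point + N%:R * \int[mu]_z f z).
Proof.
move=> cf; have mf := continuous_circle_measurable cf.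
have [B fB] := continuous_circle_bounded cf.
rewrite (Rintegral_average _ _ mf fB); congr (_ * _).
rewrite big_ord_recl /= Rintegral_push//; congr (_ + _).
  rewrite -[RHS](Rintegral_prob_cst mu); apply: eq_Rintegral => z _.
  by congr f; apply: val_inj; rewrite /= expr0.
by rewrite big_const_ord iter_addr_0 mulr_natl.
Qed.

Lemma add_fixed_mass_invariant mu N : Pp mu -> Pp (add_fixed_mass mu N).
Proof.
move=> /invariant_probP inv; apply/invariant_probP => f cf.
rewrite !Rintegral_add_fixed_mass//; last exact: (continuous_comp_powc (n := p) cf).
by rewrite inv// powc_point.
Qed.

Lemma add_fixed_mass_cvg mu : add_fixed_mass mu N @[N --> \oo] --> mu.
Proof.
apply/cvg_prob => f cf; have mf := continuous_circle_measurable cf.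
have [B fB] := continuous_circle_bounded cf.
have IB := Rintegral_prob_norm_le mu mf fB.
apply/cvgrPdist_le => e e0; near=> N.
have NB : 2 * B / e <= N%:R by near: N; exact: nbhs_infty_ger.
rewrite Rintegral_add_fixed_mass//; set I := \int[mu]_z f z in IB *.
have N0 : 0 < N.+1%:R :> R by rewrite ltr0n.
have -> : I - N.+1%:R^-1 * (f point + N%:R * I) = N.+1%:R^-1 * (I - f point).
  have -> : N%:R = N.+1%:R - 1 :> R by rewrite -natr1 addrK.
  by field; rewrite gt_eqF.
rewrite normrM ger0_norm ?invr_ge0 ?(ltW N0)// mulrC ler_pdivrMr// -natr1.
rewrite ler_pdivrMr// in NB.
by have := fB point; rewrite !ler_norml in IB *; lra.
Unshelve. all: by end_near. Qed.

(** If mu^(k) = 0, the added mass brings the coefficient to 1/(N+1). *)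
Lemma nonzero_coef_dense V k : open V -> V `&` Pp !=set0 ->
  V `&` nonzero_coef k `&` Pp !=set0.
Proof.
move=> oV [mu [Vmu inv]].
have [mu0|mu0] := eqVneq (fourier_modulus k mu) 0; last by exists mu.
have /(@add_fixed_mass_cvg mu) [N _ HN] : nbhs mu V by exact: open_nbhs_nbhs.
exists (add_fixed_mass mu N); split; last exact: add_fixed_mass_invariant.
split; first by apply: HN => /=.
apply/negP => /eqP /fourier_modulus_eq0 [+ _].
have [Re0 _] := fourier_modulus_eq0 mu0.
rewrite Rintegral_add_fixed_mass; last exact: continuous_ReX.
rewrite Re0 mulr0 addr0 /ReX powc_point /= mulr1 => /eqP.
by rewrite invr_eq0 pnatr_eq0.
Qed.

(** The factor 1/2 makes room for a strict, hence open, inequality when the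
    coefficients of the approximating measures are exactly equal. *)
Definition recurrent_coef k N : set (prob R) :=
  \bigcup_(n in [set n | (N <= n)%N])
    [set mu | fourier_modulus k mu / 2 < fourier_modulus (q ^ n) mu].

Lemma open_recurrent_coef k N : open (recurrent_coef k N).
Proof.
apply: bigcup_open => n _.
pose h mu := fourier_modulus (q ^ n) mu - fourier_modulus k mu / 2.
have ch : continuous h.
  move=> mu; have c1 := @continuous_fourier_modulus R (q ^ n) mu.
  have c2 := @continuous_fourier_modulus R k mu.
  exact: (cvgB c1 (cvgM c2 (cvg_cst _))).
have -> : [set mu | fourier_modulus k mu / 2 < fourier_modulus (q ^ n) mu] =
    h @^-1` [set x | 0 < x].
  by apply/seteqP; split => mu /=; rewrite /h subr_gt0.
by move/continuousP : ch; apply; exact: open_gt.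
Qed.

(** Non-vanishing of the coefficient at q^p is an open condition, so it passes from
    mu to its orbit measures, where that coefficient recurs exactly. *)
Lemma recurrent_coef_dense V N : (2 <= q)%N -> open V -> V `&` Pp !=set0 ->
  V `&` recurrent_coef (q ^ p) N `&` Pp !=set0.
Proof.
move=> hq oV VP; have [mu [VCmu inv]] := nonzero_coef_dense (q ^ p) oV VP.
have oVC := openI oV (@open_nonzero_coef (q ^ p)).
have [M HM] := orbit_measure_in oVC VCmu inv.
have [L L0 HL] := expn_sub1_eventual_period hp hq.
pose m := (L * M.+1).+1.
have Mm : (M <= m)%N by rewrite /m; nia.
have [Vm Cm] := HM m Mm.
have m2 : (2 <= m)%N by rewrite /m; nia.
exists (orbit_measure p m mu); split; last exact: orbit_measure_invariant.
split => //.
have [n Nn En] := HL M.+1 N.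
exists (p + n)%N => /=; first by rewrite (leq_trans Nn)// leq_addl.
rewrite /fourier_modulus (fourier_orbit_measure _ _ _ En) //.
rewrite -/(fourier_modulus _ _).
have : 0 < fourier_modulus (q ^ p) (orbit_measure p m mu).
  by rewrite lt_neqAle eq_sym Cm /= /fourier_modulus fourierE sqrtr_ge0.
by move: (fourier_modulus _ _) => x x0; rewrite ltr_pdivrMr//; lra.
Qed.

End density.

(** * Lebesgue measure and the theorem *)

Section lebesgue.
Variable R : realType.

(** Adding 1 makes the integrand nonnegative, as the formula for the uniform
    law requires. *)
Lemma uniform_integral_derive (H h : R -> R) : (forall x : R, is_derive x 1 H (h x)) ->
  continuous h -> (forall x, `|h x| <= 1) -> H 0 = H 1 ->
  \int[uniform_prob (@ltr01 R)]_x h x = 0.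
Proof.
move=> dH ch h1 H01.
have mh : measurable_fun setT h by exact: continuous_measurable_fun.
have mg : measurable_fun setT (fun x => h x + 1) by exact: measurable_funD.
suff : \int[uniform_prob (@ltr01 R)]_x (h x + 1) = 1.
  rewrite RintegralD//; last 2 first.
  - exact: (@bounded_integrable _ _ _ (uniform_prob (@ltr01 R)) h 1).
  - exact: finite_measure_integrable_cst.
  by rewrite Rintegral_prob_cst => /(canRL (addrK _)); rewrite subrr.
have g0 x : (0 <= (h x + 1)%:E)%E by rewrite lee_fin; have := h1 x; rewrite ler_norml; lra.
rewrite /Rintegral integral_uniform//; last exact/measurable_EFinP.
have dG (x : R) : is_derive x 1 (fun x => H x + x) (h x + 1).
  exact: is_deriveD.
rewrite (@continuous_FTC2 _ _ (fun x => H x + x))//; last 3 first.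
- apply: continuous_subspaceT => x; exact: (cvgD (ch x) (cvg_cst _)).
- have dc (x : R) : continuous_at x (fun x => H x + x).
    by apply: differentiable_continuous; apply/derivable1_diffP; exact: ex_derive.
  split.
  + by move=> x _; exact: ex_derive.
  + by apply: cvg_at_right_filter; exact: dc.
  + by apply: cvg_at_left_filter; exact: dc.
- by move=> x _; rewrite derive1E derive_val.
by rewrite -EFinB H01 addr0 addrAC subrr add0r subr0 invr1 mul1e.
Qed.

Lemma continuous_scaled (h : R -> R) (c : R) : continuous h -> continuous (fun x => h (c * x)).
Proof.
move=> ch x; apply: (@continuous_comp _ _ _ (fun y => c * y)); last exact: ch.
by apply: cvgM; [exact: cvg_cst|exact: cvg_id].
Qed.

Let pi2 : 2 * pi != 0 :> R.
Proof. by rewrite mulf_neq0// gt_eqF// pi_gt0. Qed.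

Lemma Leb_ReX1 : \int[@Leb R]_z ReX 1 z = 0.
Proof.
have cf := @continuous_ReX R 1; have [B fB] := continuous_circle_bounded cf.
rewrite (Rintegral_distribution _ _ (continuous_circle_measurable cf) fB).
under eq_Rintegral do rewrite /ReX powc1 /=.
apply: (@uniform_integral_derive (fun x => (2 * pi)^-1 * sin (2 * pi * x))).
- by move=> x; apply: is_derive_eq; rewrite /GRing.scale /= mulr1 mulrC mulfK.
- exact: continuous_scaled (@continuous_cos R).
- by move=> x; rewrite ler_norml cos_geN1 cos_le1.
- by rewrite mulr0 mulr1 sin0 mulr_natl sin2pi.
Qed.

Lemma Leb_ImX1 : \int[@Leb R]_z ImX 1 z = 0.
Proof.
have cf := @continuous_ImX R 1; have [B fB] := continuous_circle_bounded cf.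
rewrite (Rintegral_distribution _ _ (continuous_circle_measurable cf) fB).
under eq_Rintegral do rewrite /ImX powc1 /=.
apply: (@uniform_integral_derive (fun x => - (2 * pi)^-1 * cos (2 * pi * x))).
- move=> x; apply: is_derive_eq; rewrite /GRing.scale /= mulr1.
  by rewrite !mulNr mulrN opprK mulrC mulfK.
- exact: continuous_scaled (@continuous_sin R).
- by move=> x; rewrite ler_norml sin_geN1 sin_le1.
- by rewrite mulr0 mulr1 cos0 mulr_natl cos2pi.
Qed.

Lemma push_cvg_Leb_fourier q (mu : prob R) :
  push (q ^ n) mu @[n --> \oo] --> @Leb R ->
  fourier_modulus (q ^ n) mu @[n --> \oo] --> (0 : R).
Proof.
move=> /cvg_prob H.
have HR := H _ (@continuous_ReX R 1); have HI := H _ (@continuous_ImX R 1).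
rewrite Leb_ReX1 in HR; rewrite Leb_ImX1 in HI.
have E (f : nat -> circle R -> R) n : (forall k, continuous (f k)) ->
    (forall z, f 1%N (powc (q ^ n) z) = f (q ^ n)%N z) ->
    \int[push (q ^ n) mu]_z f 1%N z = \int[mu]_z f (q ^ n)%N z.
  by move=> cf fE; rewrite Rintegral_push//; apply: eq_Rintegral => z _.
have -> : (fun n => fourier_modulus (q ^ n) mu) = fun n =>
    Num.sqrt ((\int[push (q ^ n) mu]_z ReX 1 z) ^+ 2 + (\int[push (q ^ n) mu]_z ImX 1 z) ^+ 2).
  apply/funext => n; rewrite (E (@ReX R)) ?(E (@ImX R)) //;
    by [exact: continuous_ReX|exact: continuous_ImX|move=> z; rewrite /ReX /ImX powc1].
have H2 := cvgD (cvgM HR HR) (cvgM HI HI); rewrite mulr0 addr0 in H2.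
rewrite -(@sqrtr0 R); apply: (@cvg_comp _ _ _ _ Num.sqrt _ _ _ _ (@sqrt_continuous R _)).
exact: H2.
Qed.

End lebesgue.

Section limsup.
Lemma limn_esup_gt0 (R : realType) (u : nat -> R) (c : R) : 0 < c ->
  (forall N, exists2 n, (N <= n)%N & c < u n) -> (0 < limn_esup (fun n => (u n)%:E))%E.
Proof.
move=> c0 H; rewrite limn_esup_lim; apply: (@lt_le_trans _ _ c%:E); first by rewrite lte_fin.
apply: lime_ge; first exact: is_cvg_esups.
apply: nearW => N; have [n Nn cn] := H N.
apply: (@le_trans _ _ (u n)%:E); first by rewrite lee_fin ltW.
by apply: ereal_sup_ubound; exists n.
Qed.
End limsup.

Lemma Spq_sub_Gpq (R : realType) (p q : nat) : @Spq R p q `<=` @Gpq R p q.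
Proof.
move=> mu [amu Smu]; split => // /push_cvg_Leb_fourier H.
have : (fourier_modulus (q ^ n) (val mu))%:E @[n --> \oo] --> (0%E : \bar R).
  exact: cvg_EFin (nearW _ _) H.
move=> /cvg_limn_einf_sup [_ H0].
by move: Smu; rewrite [limn_esup _]H0 ltxx.
Qed.

Theorem theorem1p5 (R : realType) (p q : nat) (hp : (2 <= p)%N)
    (hq : (2 <= q)%N) (hpq : p <> q) :
  residual (@Spq R p q) /\ residual (@Gpq R p q).
Proof.
suff [D GD DS] : residual (@Spq R p q).
  by split; exists D => //; exact: subset_trans DS (@Spq_sub_Gpq _ _ _).
pose O n : set (prob R) :=
  atoms_below n.+1%:R^-1 `&` nonzero_coef (q ^ p) `&` recurrent_coef q (q ^ p) n.
have oO n : open (O n).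
  apply: openI; last exact: open_recurrent_coef.
  by apply: openI; [exact: open_atoms_below|exact: open_nonzero_coef].
have dO n V : open V -> V `&` @invariant_prob R p !=set0 ->
    V `&` O n `&` @invariant_prob R p !=set0.
  move=> oV VP.
  have VP1 := atoms_below_dense hp n oV VP.
  have oV1 := openI oV (@open_atoms_below R n.+1%:R^-1).
  have VP2 := nonzero_coef_dense (q ^ p) oV1 VP1.
  have oV2 := openI oV1 (@open_nonzero_coef R (q ^ p)).
  have := recurrent_coef_dense hp n hq oV2 VP2.
  by rewrite /O !setIA.
exists (\bigcap_n (set_val : @invariant_prob R p -> prob R) @^-1` O n).
  split.
    by exists (fun n => set_val @^-1` O n) => // n; exists (O n).
  move=> W [mu Wmu] [V oV VW].
  have VP : V `&` @invariant_prob R p !=set0.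
    by exists (val mu); split; [rewrite -VW in Wmu|exact: set_valP].
  have [nu [Pnu Vnu Onu]] := compact_regular_baire (@compact_prob R) (@regular_prob R)
    (@closed_invariant_prob R p) oO dO oV VP.
  exists (SigSub (mem_set Pnu) : @invariant_prob R p); split.
    by rewrite -VW.
  by move=> n _; exact: Onu.
move=> mu Dmu; split.
  move=> z; apply/eqP; rewrite eq_le measure_ge0 andbT leNgt; apply/negP => muz.
  have mz := measurable_circle_set1 z.
  have muzf := fin_prob (val mu) mz.
  have mu0 : 0 < fine (val mu [set z]) by rewrite fine_gt0// muz ltey_eq muzf.
  have [[+ _] _] := Dmu (Num.truncn (fine (val mu [set z]))^-1) I.
  move=> /(_ z); rewrite -[X in (X < _)%E](fineK muzf) lte_fin ltNge => /negP; apply.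
  by apply/ltW; rewrite invf_plt ?posrE ?ltr0n//; exact: truncnS_gt.
have [[_ +] _] := Dmu 0%N I; rewrite /nonzero_coef /= => nz.
apply: (@limn_esup_gt0 _ _ (fourier_modulus (q ^ p) (val mu) / 2)).
  by rewrite divr_gt0// lt_neqAle eq_sym nz /= /fourier_modulus fourierE sqrtr_ge0.
by move=> N; have [_ [n /= Nn Hn]] := Dmu N I; exists n.
Qed.
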